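(* Let $d\in\mathbb{N}$ and let $\boldsymbol{Q}=(Q_{\boldsymbol{i}})_{\boldsymbol{i}\in\mathbb{Z}^d}$ be an arbitrary random element of $l_0$ satisfying $\|\boldsymbol{Q}\|=1$ a.s. and $\mathbb{E}\left[\sum_{\boldsymbol{k}\in\mathbb{Z}^d}|Q_{\boldsymbol{k}}|^{\alpha}\right]<\infty$ for some $\alpha>0$. Define $\boldsymbol{Z}:=Y\cdot\boldsymbol{Q}$, where $Y$ is a $\mathrm{Pareto}(\alpha)$-distributed random variable independent of $\boldsymbol{Q}$. Then $\mathbb{E}|\mathrm{e}(\boldsymbol{Z})|<\infty$, and the exceedance-stationary process generated by $\boldsymbol{Z}$, that is, a random element $\boldsymbol{Y}$ of $\mathcal{E}_0$ with distribution satisfying $$\mathbb{E}[h(\boldsymbol{Y})]=\frac{1}{\mathbb{E}|\mathrm{e}(\boldsymbol{Z})|}\,\mathbb{E}\left[\sum_{\boldsymbol{k}\in\mathrm{e}(\boldsymbol{Z})}h(\varphi_{\boldsymbol{k}}\boldsymbol{Z})\right]\quad\text{for all measurable } h:\mathcal{E}_0\to[0,\infty),$$ is the tail process of some stationary regularly varying random field with tail index $\alpha$.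
   Context: $\mathrm{Pareto}(\alpha)$ means $\mathbb{P}(Y>y)=y^{-\alpha}$ for $y\ge1$. $\mathbb{R}^{\mathbb{Z}^d}$ carries the product $\sigma$-algebra; $|\boldsymbol{i}|=\max_k|i_k|$ for $\boldsymbol{i}\in\mathbb{Z}^d$. $l_0=\{\boldsymbol{x}\in\mathbb{R}^{\mathbb{Z}^d}:\lim_{|\boldsymbol{i}|\to\infty}|x_{\boldsymbol{i}}|=0\}$ with norm $\|\boldsymbol{x}\|=\sup_{\boldsymbol{i}}|x_{\boldsymbol{i}}|$. For $\boldsymbol{k}\in\mathbb{Z}^d$ the shift is $\varphi_{\boldsymbol{k}}\boldsymbol{x}=(x_{\boldsymbol{i}+\boldsymbol{k}})_{\boldsymbol{i}\in\mathbb{Z}^d}$. $\mathrm{e}(\boldsymbol{x})=\{\boldsymbol{k}:|x_{\boldsymbol{k}}|>1\}$, with cardinality $|\mathrm{e}(\boldsymbol{x})|$; $\mathcal{E}_0=\{\boldsymbol{x}\in\mathbb{R}^{\mathbb{Z}^d}:|x_{\boldsymbol{0}}|>1,|\mathrm{e}(\boldsymbol{x})|<\infty\}$. The phrase ''exceedance-stationary process generated by $\boldsymbol{Z}$'' is just a name for a process with the displayed distribution. Tail process: $\boldsymbol{Y}=(Y_{\boldsymbol{i}})_{\boldsymbol{i}\in\mathbb{Z}^d}$ is the tail process of a (strictly) stationary real-valued random field $\boldsymbol{X}$ if $\mathbb{P}(|Y_{\boldsymbol{0}}|>1)=1$ and, for every $m\in\mathbb{N}$, the conditional distribution of $(u^{-1}X_{\boldsymbol{i}})_{\boldsymbol{i}\in\{-m,\dots,m\}^d}$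 given $|X_{\boldsymbol{0}}|>u$ converges weakly, as $u\to\infty$, to the distribution of $(Y_{\boldsymbol{i}})_{\boldsymbol{i}\in\{-m,\dots,m\}^d}$. A stationary field admitting a tail process is called regularly varying; it is known that then $|Y_{\boldsymbol{0}}|$ is $\mathrm{Pareto}(\alpha)$-distributed for some $\alpha>0$, called the tail index. *)

(* Defs.v *)
From HB Require Import structures.
Set Warnings "-notation-overridden,-notation-incompatible-prefix".
From mathcomp Require Export all_boot all_order all_algebra.
From mathcomp Require Export all_classical all_reals all_analysis.
Export Order.TTheory GRing.Theory Num.Theory.
Export numFieldNormedType.Exports.

Set Implicit Arguments.
Unset Strict Implicit.
Unset Printing Implicit Defensive.

Local Open Scope classical_set_scope.
Local Open Scope ring_scope.

Notation Zd d := {ffun 'I_d -> int}.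

Definition znorm (d : nat) (i : Zd d) : nat := \max_(k < d) `|i k|%N.

Definition cylinders (I : Type) (R : realType) : set (set (I -> R)) :=
  \bigcup_(i in [set: I])
    preimage_set_system [set: I -> R] (fun x => x i) measurable.

(* R^I with the product sigma-algebra *)
Notation paths I R := (g_sigma_algebraType (@cylinders I R)).

Section Paths.
Context (R : realType) (d : nat).
Implicit Types x : paths (Zd d) R.

Definition translate (k : Zd d) x : paths (Zd d) R := fun i => x (i + k).

Definition l0 : set (paths (Zd d) R) :=
  [set x | forall e : R, 0 < e ->
    exists N : nat, forall i, (N <= znorm i)%N -> `|x i| < e].

Definition supnorm x : \bar R := ereal_sup [set `|x i|%:E | i in [set: Zd d]].

Definition exc x : set (Zd d) := [set k | 1 < `|x k|].

Definition E0 : set (paths (Zd d) R) :=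
  [set x | 1 < `|x 0| /\ finite_set (exc x)].

Definition box (m : nat) := {i : Zd d | (znorm i <= m)%N}.

Definition window (m : nat) x : paths (box m) R := fun i => x (val i).

End Paths.

Arguments window {R d} m x _.

Section RandomElements.
Context (R : realType).

Definition pareto (disp : measure_display) (T : measurableType disp)
    (P : probability T R) (Y : T -> R) (alpha : R) :=
  forall y : R, 1 <= y -> P [set w | y < Y w] = (y `^ (- alpha))%:E.

Definition independent (disp disp1 disp2 : measure_display)
    (T : measurableType disp) (T1 : measurableType disp1)
    (T2 : measurableType disp2) (P : probability T R)
    (X : {RV P >-> T1}) (Y : {RV P >-> T2}) :=
  forall A B, measurable A -> measurable B ->
    P (X @^-1` A `&` Y @^-1` B) = (P (X @^-1` A) * P (Y @^-1` B))%E.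

(* The law of X given A; identically 0 when P A = 0. *)
Definition cond_law (disp disp' : measure_display) (T : measurableType disp)
    (T' : measurableType disp') (P : probability T R) (A : set T)
    (X : T -> T') : set T' -> \bar R :=
  fun B => (P (A `&` X @^-1` B) / P A)%E.

(* Weak convergence of laws on R^I, I finite, tested against bounded functions
   that are continuous for the product topology. *)
Definition weak_cvg (I : Type) (S : Type) (F : set_system S)
    (mu : S -> set (paths I R) -> \bar R) (nu : set (paths I R) -> \bar R) :=
  forall f : {ptws I -> R} -> R,
    continuous f -> (exists M : R, forall x, `|f x| <= M) ->
    (\int[mu u]_x (f x)%:E)%E @[u --> F] --> (\int[nu]_x (f x)%:E)%E.

Section Fields.
Context (d : nat).

Definition stationary (disp : measure_display) (T : measurableType disp)
    (P : probability T R) (X : {RV P >-> paths (Zd d) R}) :=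
  forall (k : Zd d) (A : set (paths (Zd d) R)), measurable A ->
    P [set w | A (translate k (X w))] = P [set w | A (X w)].

(* W, on its own probability space, is the tail process of the stationary
   field X; the third conjunct makes conditioning on |X_0| > u meaningful. *)
Definition tail_process
    (disp : measure_display) (T : measurableType disp) (P : probability T R)
    (X : {RV P >-> paths (Zd d) R})
    (disp' : measure_display) (T' : measurableType disp') (P' : probability T' R)
    (W : {RV P' >-> paths (Zd d) R}) :=
  [/\ stationary X,
      P' [set w | 1 < `|W w 0|] = 1%E,
      forall u : R, (0 < P [set w | (u < `|X w 0|)%R])%E &
      forall m : nat,
        weak_cvg +oo
          (fun u : R => cond_law P [set w | u < `|X w 0|]
                          (fun w => window m (fun i => u^-1 * X w i)))
          (pushforward P' (fun w => window m (W w)))].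

Definition regularly_varying
    (disp : measure_display) (T : measurableType disp) (P : probability T R)
    (X : {RV P >-> paths (Zd d) R}) (alpha : R) :=
  exists (disp' : measure_display) (T' : measurableType disp')
         (P' : probability T' R) (W : {RV P' >-> paths (Zd d) R}),
    tail_process X W /\ pareto P' (fun w => `|W w 0|) alpha.

Definition mean_exc (disp : measure_display) (T : measurableType disp)
    (P : probability T R) (Z : T -> paths (Zd d) R) : \bar R :=
  (\int[P]_w counting (exc (Z w)))%E.

Definition exc_stationary_process
    (disp : measure_display) (T : measurableType disp) (P : probability T R)
    (Z : T -> paths (Zd d) R)
    (disp' : measure_display) (T' : measurableType disp') (P' : probability T' R)
    (W : {RV P' >-> paths (Zd d) R}) :=
  (forall w, E0 (W w)) /\
  forall h : paths (Zd d) R -> R,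
    measurable_fun (@E0 R d) h -> (forall x, E0 x -> 0 <= h x) ->
    (\int[P']_w (h (W w))%:E =
     (mean_exc P Z)^-1 *
       \int[P]_w \esum_(k in exc (Z w)) (h (translate k (Z w)))%:E)%E.

End Fields.
End RandomElements.

(* Main.v *)
Require Import Defs.
From mathcomp Require Import zify measurable_realfun.

(** The finiteness of E|e(Z)| holds because, given Q, the event |Y Q_k| > 1 has
    probability at most |Q_k|^alpha ([pareto_mul_indep_le]); summing over k gives
    the assumed moment. The law of the exceedance-stationary process is then an
    honest probability law: it is that of Z shifted to a random point of e(Z),
    with total weight E|e(Z)| ([cluster_law]).

    A tail process sees only one extremal event at a time, and stationarity can be
    had by averaging over shifts, so the stationary field is made of a single
    cluster wrapped around a large random torus. Let wrap_n be the projection of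
    Z^d onto the box |k| <= n with the opposite sides identified, let N : R -> nat
    grow slowly to infinity, and let X_i = Y Q_{wrap_n(i + U)}, where n = N(Y), U is uniform on the box and
    the law of (Y, Q) is reweighted by the number of points of the box. The weight
    cancels the uniform density, so that
      E h(X) = m^-1 E [ sum over |k| <= N(Y) of h((Y Q_{wrap_{N(Y)}(i + k)})_i) ],
    with m = E #{k : |k| <= N(Y)}, which is finite when N grows slowly enough
    ([exists_torus_scale]). Adding a constant modulo n permutes the box, whence X
    is exactly stationary ([torus_law_stationary]).

    The tail follows from scaling. On Y > u the pair (Y/u, Q) has u^-alpha times
    the law of (Y, Q) ([joint_scaling]), and |Q| <= 1 makes |X_0| > u impossible
    elsewhere. Therefore, for u >= 1 ([torus_tail_integral]),
      E [f(X/u); |X_0| > u] = m^-1 u^-alpha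
        E [ sum over k in e(Z), |k| <= N(uY), of f((Y Q_{wrap_{N(uY)}(i + k)})_i) ].
    Let f depend on finitely many coordinates. As u grows, N(uY) passes every bound
    and e(Z) is finite, so for each outcome the sum eventually equals the sum of
    f(phi_k Z) over k in e(Z); it is dominated by a multiple of |e(Z)|. Dividing
    by the same expression for f = 1 gives, in the limit, the law of the
    exceedance-stationary process. Test functions have to be measurable for this,
    which continuity provides ([measurable_continuous]). The scaling identity also
    shows that the modulus at 0 of the exceedance-stationary process is
    Pareto(alpha) ([exc_stationary_pareto]). *)

Set Implicit Arguments.
Unset Strict Implicit.

Local Open Scope classical_set_scope.
Local Open Scope ring_scope.

(** * Random sums over a countable index set *)

Section CountableSums.
Local Open Scope ereal_scope.
Context (R : realType) (I : countType).

Lemma esum_nneseries (a : I -> \bar R) : (forall k, 0 <= a k) ->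
  \esum_(k in [set: I]) a k = \sum_(n <oo) oapp a 0 (pickle_inv n).
Proof.
move=> a0; rewrite nneseries_esumT; last by move=> n; case: pickle_inv => /=.
have pbij : set_bij [set: I] (range (@pickle I)) (@pickle I).
  split; [by move=> k _; exists k|exact: in2W (pcan_inj pickleK_inv)|by []].
transitivity (\esum_(k in [set: I]) oapp a 0 (pickle_inv (pickle k))).
  by apply: eq_esum => k _; rewrite pickleK_inv.
rewrite -(reindex_esum _ _ _ (fun n => oapp a 0 (pickle_inv n)) pbij).
rewrite esum_mkcond; apply: eq_esum => n _; case: ifPn => // /negP nr.
case E : (pickle_inv n) => [k|]//=; exfalso; apply: nr; rewrite inE; exists k => //.
by have := @pickle_invK I n; rewrite /ocancel E.
Qed.

Context d (T : measurableType d).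

Lemma measurable_esum (f : I -> T -> \bar R) :
  (forall k, measurable_fun setT (f k)) -> (forall k w, 0 <= f k w) ->
  measurable_fun setT (fun w => \esum_(k in [set: I]) f k w).
Proof.
move=> mf f0; under eq_fun do rewrite esum_nneseries//.
by apply: ge0_emeasurable_sum => n; case: pickle_inv => [k|]//=.
Qed.

Lemma integral_esum (P : {measure set T -> \bar R}) (f : I -> T -> \bar R) :
  (forall k, measurable_fun setT (f k)) -> (forall k w, 0 <= f k w) ->
  \int[P]_w (\esum_(k in [set: I]) f k w) = \esum_(k in [set: I]) \int[P]_w f k w.
Proof.
move=> mf f0; rewrite esum_nneseries; last by move=> k; exact: integral_ge0.
under eq_integral do rewrite esum_nneseries//.
rewrite integral_nneseries//; last 2 first.
- by move=> n; case: pickle_inv => [k|]//=.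
- by move=> n w _; case: pickle_inv => [k|]//=.
apply: eq_eseriesr => n _; case: pickle_inv => [k|]//=.
by rewrite integral0.
Qed.

(** Trades the random index set for a fixed one, over which sums and integrals
    commute. *)
Lemma esum_patch (S : T -> set I) (f : I -> T -> \bar R) w :
  \esum_(k in S w) f k w =
  \esum_(k in [set: I]) (f k \_ [set w | S w k]) w.
Proof.
rewrite esum_mkcond; apply: eq_esum => k _; rewrite patchE.
by congr (if _ then _ else _); apply/idP/idP; rewrite !inE.
Qed.

Lemma measurable_patch (A : set T) (f : T -> \bar R) :
  measurable A -> measurable_fun setT f -> measurable_fun setT (f \_ A).
Proof.
move=> mA mf; apply/(measurable_restrictT _ _).1 => //.
exact: measurable_funTS.
Qed.

Lemma measurable_random_esum (S : T -> set I) (f : I -> T -> \bar R) :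
  (forall k, measurable [set w | S w k]) ->
  (forall k, measurable_fun setT (f k)) -> (forall k w, 0 <= f k w) ->
  measurable_fun setT (fun w => \esum_(k in S w) f k w).
Proof.
move=> mS mf f0; under eq_fun do rewrite esum_patch.
apply: measurable_esum => [k|k w]; first exact: measurable_patch.
by rewrite patchE; case: ifP.
Qed.

Lemma integral_random_esum (P : {measure set T -> \bar R}) (S : T -> set I)
    (f : I -> T -> \bar R) :
  (forall k, measurable [set w | S w k]) ->
  (forall k, measurable_fun setT (f k)) -> (forall k w, 0 <= f k w) ->
  \int[P]_w (\esum_(k in S w) f k w) =
  \esum_(k in [set: I]) \int[P]_(w in [set w | S w k]) f k w.
Proof.
move=> mS mf f0; under eq_integral do rewrite esum_patch.
rewrite integral_esum; last 2 first.
- by move=> k; exact: measurable_patch.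
- by move=> k w; rewrite patchE; case: ifP.
by apply: eq_esum => k _; rewrite [RHS]integral_mkcond.
Qed.

End CountableSums.

(** * The law of a cluster seen from one of its points *)

(* The image of a measure, with the measurability of the map as an argument: a
   family of images has to be a family of measures before it can be summed. *)
Local Notation image_measure :=
  measure_function_pushforward__canonical__measure_function_Measure (only parsing).

Section SizeBias.
Local Open Scope ereal_scope.
Context (R : realType) d (T : measurableType d) (P : {measure set T -> \bar R}).

Lemma ge0_integral_mrestr (A : set T) (mA : measurable A) (h : T -> \bar R) :
  measurable_fun setT h -> (forall x, 0 <= h x) ->
  \int[mrestr P mA]_x h x = \int[P]_(x in A) h x.
Proof.
move=> mh h0; have mnA := measurableC mA.
rewrite [LHS](ge0_negligible_integral mnA)//=; last by rewrite /mrestr setICl measure0.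
rewrite setDE setCK setTI; apply: eq_measure_integral => B _ BA.
by rewrite /= /mrestr setIidl.
Qed.

Context d' (T' : measurableType d') (I : countType).
Context (S : T -> set I) (g : I -> T -> T').
Hypothesis mS : forall k, measurable [set w | S w k].
Hypothesis mg : forall k, measurable_fun setT (g k).

Let cluster_measure : exists nu : {measure set T' -> \bar R},
  forall h : T' -> \bar R, measurable_fun setT h -> (forall x, 0 <= h x) ->
  \int[nu]_x h x = \int[P]_w (\esum_(k in S w) h (g k w)).
Proof.
pose nuk (o : option I) : {measure set T' -> \bar R} :=
  if o is Some k then
    image_measure
      (mrestr P (mS k)) (mg k)
  else mzero.
exists (mseries (fun n => nuk (pickle_inv n)) 0%N) => h mh h0.
rewrite ge0_integral_measure_series// integral_random_esum//; last first.
  by move=> k; exact: measurableT_comp.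
rewrite esum_nneseries; last by move=> k; exact: integral_ge0.
apply: eq_eseriesr => n _; case: pickle_inv => [k|] /=; last first.
  exact: integral_measure_zero.
rewrite ge0_integral_pushforward// preimage_setT ge0_integral_mrestr//.
  exact: measurableT_comp.
by move=> w; exact: h0.
Qed.

(** Summing over k the law of g k restricted to the event that k belongs to S gives
    a measure of total mass E #S, and normalising it a probability. Both the
    exceedance-stationary process (S = e(Z), g k the shift of Z by k) and the
    stationary field with a given tail (S a box, g k the shift on a torus) have a
    law of this kind. *)
Lemma cluster_law :
  let m := \int[P]_w (\esum_(k in S w) 1) in m != 0 -> m < +oo ->
  exists nu : probability T' R,
  forall h : T' -> \bar R, measurable_fun setT h -> (forall x, 0 <= h x) ->
  \int[nu]_x h x = m^-1 * \int[P]_w (\esum_(k in S w) h (g k w)).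
Proof.
move=> m m0 moo; have [nu nuE] := cluster_measure.
have m_ge0 : 0 <= m.
  by apply: integral_ge0 => w _; apply: esum_ge0 => k _; exact: lee01.
have nuT : nu setT = m.
  by rewrite -[LHS]mul1e -integral_cst// nuE//= => x; exact: lee01.
have [y _] : exists y : T', True.
  apply: contrapT => /forallNP noT; move/negP: m0; apply; apply/eqP.
  rewrite -nuT (_ : setT = set0) ?measure0//.
  by apply/seteqP; split=> // x _; exact: (noT x).
have finm : m \is a fin_num by rewrite ge0_fin_numE.
exists (mnormalize nu (dirac y)) => h mh h0; rewrite -nuE//.
have -> : m^-1 = ((fine m)^-1)%:E.
  by rewrite -[in LHS](fineK finm) inver fine_eq0// (negPf m0).
have k0 : (0 <= (fine m)^-1)%R by rewrite invr_ge0 fine_ge0.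
rewrite -(ge0_integral_mscale nu measurableT (NngNum k0))//.
apply: eq_measure_integral => A mA _.
rewrite /= /mnormalize nuT ifF; last first.
  by apply/negbTE; rewrite negb_or m0 /= lt_eqF.
exact: muleC.
Qed.

End SizeBias.

(** * Measurability on path spaces *)

Section PathMeasurability.
Context (R : realType).

Lemma measurable_coordinate (I : Type) (i : I) :
  measurable_fun [set: paths I R] (fun x : paths I R => x i).
Proof. by move=> mT A mA; apply: sub_sigma_algebra; exists i => //; exists A. Qed.

Lemma measurable_paths (I : Type) d (T : measurableType d) (f : T -> paths I R) :
  (forall i, measurable_fun setT (fun w => f w i)) -> measurable_fun setT f.
Proof.
move=> mf; apply: (@measurability _ _ T (paths I R) setT f (@cylinders I R)) => //.
move=> _ [B [i _ [A mA <-]] <-].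
by rewrite !setTI; have := mf i measurableT A mA; rewrite setTI.
Qed.

Lemma measurable_path_comp (I : Type) d (T : measurableType d) (f : T -> paths I R) :
  measurable_fun setT f -> forall i, measurable_fun setT (fun w => f w i).
Proof.
move=> mf i.
exact: (measurableT_comp (measurable_coordinate i) mf).
Qed.

(** Used when a discrete random quantity, such as the size of a torus, selects which
    of countably many measurable maps is applied. *)
Lemma measurable_countable_case (K : countType) d (T : measurableType d)
    d' (T' : measurableType d') (N : T -> K) (F : K -> T -> T') :
  (forall n, measurable [set w | N w = n]) ->
  (forall n, measurable_fun setT (F n)) ->
  measurable_fun setT (fun w => F (N w) w).
Proof.
move=> mN mF _ B mB; rewrite setTI.
rewrite (_ : _ @^-1` B = \bigcup_(n in [set: K]) ([set w | N w = n] `&` F n @^-1` B)).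
  apply: countable_bigcupT_measurable => // n; apply: measurableI => //.
  by rewrite -[X in measurable X]setTI; exact: mF.
apply/seteqP; split=> [w Bw|w [n _ [/= <-]]//].
by exists (N w).
Qed.

Lemma measurable_floor_level d (T : measurableType d) (f : T -> R) (z : int) :
  measurable_fun setT f -> measurable [set w | Num.floor (f w) = z].
Proof.
move=> mf; rewrite (_ : [set w | _] =
    f @^-1` `[z%:~R, (z + 1)%:~R[%classic).
  by rewrite -[X in measurable X]setTI; exact: mf.
apply/seteqP; split=> w /=; rewrite in_itv/= -floor_eq; first by move=> ->.
by move/eqP.
Qed.

Lemma measurable_map_level (I : eqType) (F : I -> paths I R -> int) (s : seq I) c :
  (forall i z, measurable [set x | F i x = z]) ->
  measurable [set x | [seq F i x | i <- s] = c].
Proof.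
move=> mF; elim: s c => [|i s IH] [|z c] /=.
- by rewrite (_ : [set _ | _] = setT)//; apply/seteqP; split.
- by rewrite (_ : [set _ | _] = set0)//; apply/seteqP; split.
- by rewrite (_ : [set _ | _] = set0)//; apply/seteqP; split.
rewrite (_ : [set _ | _] = [set x | F i x = z] `&`
   [set x | [seq F i x | i <- s] = c]); first exact: measurableI.
by apply/seteqP; split=> x /= [-> ->].
Qed.

Lemma cvg_ptws (I : Type) (F : nat -> {ptws I -> R}) (x : {ptws I -> R}) :
  (forall i, F n i @[n --> \oo] --> x i) -> F n @[n --> \oo] --> x.
Proof.
move=> Fx; apply/cvg_sup => i U [/= _ [[V oV <-] /= Vx]] /filterS; apply.
apply: (Fx i); exact: open_nbhs_nbhs.
Qed.

Lemma cvg_floor_div (y : R) :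
  (Num.floor (n.+1%:R * y))%:~R / n.+1%:R @[n --> \oo] --> y.
Proof.
apply/cvgrPdist_le => e e0; near=> n.
have /andP[le1 lt1] := floor_itv (n.+1%:R * y : R).
have n0 : 0 < n.+1%:R :> R by [].
have -> : y - (Num.floor (n.+1%:R * y))%:~R / n.+1%:R =
    (n.+1%:R * y - (Num.floor (n.+1%:R * y))%:~R) / n.+1%:R.
  by rewrite mulrBl mulrAC mulfV ?gt_eqF// mul1r.
rewrite ger0_norm ?divr_ge0 ?subr_ge0//.
apply: (@le_trans _ _ n.+1%:R^-1); last first.
  by apply: ltW; near: n; exact: (near_infty_natSinv_lt (PosNum e0)).
rewrite ler_piMl ?invr_ge0 ?ltW// ltrBlDl -[1%R]/(1%:~R) -intrD.
exact: lt1.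
Unshelve. all: by end_near. Qed.

(** The cell of a grid that contains a path, coded by a finite sequence because such
    codes form a countable type while functions into the integers do not. *)
Definition digitize (I : eqType) (e : seq I) (n : nat) (x : I -> R) : seq int :=
  [seq Num.floor (n.+1%:R * x i) | i <- e].

Definition undigitize (I : eqType) (e : seq I) (n : nat) (s : seq int) : I -> R :=
  fun i => (nth 0 s (index i e))%:~R / n.+1%:R.

(** The product sigma-algebra is not defined by the topology, so this needs an
    argument: by continuity f is the pointwise limit of its values at the points
    of grids of mesh 1/(n+1), and each such approximation is constant on countably
    many measurable cells. *)
Lemma measurable_continuous (I : choiceType) (f : {ptws I -> R} -> R) :
  finite_set [set: I] -> continuous f ->
  measurable_fun [set: paths I R] (f : paths I R -> R).
Proof.
move=> finI cf; pose e : seq I := finmap.enum_fset (fset_set [set: I]).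
have eP i : i \in e by rewrite in_fset_set ?inE.
pose f_ n (x : paths I R) : R := f (undigitize e n (digitize e n x)).
apply: (@measurable_fun_cvg _ _ _ setT f_) => [n|x _].
  apply: (measurable_countable_case (F := fun s _ => f (undigitize e n s))) => s.
    apply: measurable_map_level => i z; apply: measurable_floor_level.
    by apply: measurable_funM => //; exact: measurable_coordinate.
  exact: measurable_cst.
apply: (@continuous_cvg _ _ _ _ _ _ f); first exact: cf.
apply: cvg_ptws => i.
rewrite (_ : (fun n => _) = fun n => (Num.floor (n.+1%:R * x i))%:~R / n.+1%:R).
  exact: cvg_floor_div.
apply/funext => n; rewrite /undigitize /digitize (nth_map i) ?index_mem//.
by rewrite nth_index.
Qed.

End PathMeasurability.

(** * Wrapping the lattice around a torus *)

Section Lattice.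
Context (d : nat).
Implicit Types i j k : Zd d.

Lemma znorm_leP i (n : nat) :
  reflect (forall a, (`|i a| <= n)%N) (znorm i <= n)%N.
Proof.
rewrite /znorm; apply: (iffP (bigmax_leqP _ _ _)) => h a; first exact: h.
by move=> _; exact: h.
Qed.

Lemma leq_znormD i j : (znorm (i + j)%R <= znorm i + znorm j)%N.
Proof.
apply/znorm_leP => a; rewrite ffunE.
have absD (x y : int) : (`|(x + y)%R| <= `|x| + `|y|)%N by lia.
apply: (leq_trans (absD _ _)); apply: leq_add; exact/znorm_leP.
Qed.

Lemma znorm0 : znorm (0 : Zd d) = 0%N.
Proof. by apply/eqP; rewrite -leqn0; apply/znorm_leP => a; rewrite ffunE. Qed.

Lemma finite_box (n : nat) : finite_set [set k : Zd d | (znorm k <= n)%N].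
Proof.
pose f (c : {ffun 'I_d -> 'I_(n + n).+1}) : Zd d := [ffun a => (c a)%:Z - n%:Z].
apply: (@sub_finite_set _ _ (f @` setT)); last first.
  by apply: finite_image; exact: finite_finset.
move=> k /znorm_leP kn; exists [ffun a => inord `|(k a + n%:Z)%R|%N] => //.
apply/ffunP => a; rewrite !ffunE.
have shift (x : int) : (`|x| <= n)%N ->
  (`|(x + n%:Z)%R| < (n + n).+1)%N /\ `|(x + n%:Z)%R|%N%:Z - n%:Z = x by lia.
by have [lt_shift eq_shift] := shift _ (kn a); rewrite inordK.
Qed.

Lemma finite_boxT (n : nat) : finite_set [set: box d n].
Proof.
rewrite (_ : [set: box d n] = val @^-1` [set k : Zd d | (znorm k <= n)%N]).
  by apply: finite_preimage (finite_box n) => x y _ _; exact: val_inj.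
by apply/seteqP; split=> // x _; exact: (valP x).
Qed.

(** The representative of k modulo 2n+1 in the box |k| <= n; the modulus is odd so
    that the box is centred at 0. *)
Definition wrap (n : nat) k : Zd d :=
  [ffun a => ((k a + n%:Z) %% (n + n).+1%:Z)%Z - n%:Z].

Lemma wrap_box n k : (znorm (wrap n k) <= n)%N.
Proof.
apply/znorm_leP => a; rewrite ffunE.
have shift (x : int) : 0 <= x < (n + n).+1%:Z -> (`|(x - n%:Z)%R| <= n)%N by lia.
by apply: shift; rewrite modz_ge0 ?ltz_pmod.
Qed.

Lemma wrap_id n k : (znorm k <= n)%N -> wrap n k = k.
Proof.
move=> /znorm_leP kn; apply/ffunP => a; rewrite ffunE modz_small ?addrK//.
have shift (x : int) : (`|x| <= n)%N -> 0 <= x + n%:Z < (n + n).+1%:Z by lia.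
exact: shift.
Qed.

Lemma wrapDr n i k : wrap n (i + wrap n k) = wrap n (i + k).
Proof.
apply/ffunP => a; rewrite !ffunE; congr (_ - _).
by rewrite -addrA subrK modzDmr addrA.
Qed.

(** Translations of the torus permute its fundamental domain: the source of the
    stationarity of the wrapped field. *)
Lemma wrap_bij n t : set_bij [set k | (znorm k <= n)%N] [set k | (znorm k <= n)%N]
  (fun k => wrap n (k + t)).
Proof.
have inv s k : (znorm k <= n)%N -> wrap n (wrap n (k + s) - s) = k.
  by move=> kn; rewrite addrC wrapDr addrC addrK wrap_id.
split=> [k _|k l /[!inE] kn ln /= kl|k kn] /=; first exact: wrap_box.
- by rewrite -(inv t k kn) kl inv.
- exists (wrap n (k - t)); first exact: wrap_box.
  by rewrite -{2}(inv (- t) k kn) opprK.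
Qed.

End Lattice.

(** * A size of the torus that grows slowly enough *)

Section SlowScale.
Context (R : realType) (d : nat).

Lemma bigmax_attained (n : nat) (p : pred nat) :
  let m := \max_(j < n | p j) j in m = 0%N \/ p m.
Proof.
rewrite /=; elim/big_ind: _ => [|a b ha hb|j pj]; [by left| |by right].
by rewrite /maxn; case: ifP.
Qed.

(** N(v) is the largest n <= v such that C is at most v on the whole box of radius
    n, or 0 when there is none. Each box is finite, so N tends to infinity,
    however fast C grows. The exception k = 0 comes from the default value 0. *)
Lemma exists_slow_scale (C : Zd d -> R) : exists N : R -> nat,
  [/\ forall n, measurable [set v | N v = n],
      forall k v, (znorm k <= N v)%N -> k = 0 \/ C k <= v &
      forall n, exists V : R, forall v, V <= v -> (n <= N v)%N].
Proof.
pose ok (v : R) (n : nat) := `[< forall k : Zd d, (znorm k <= n)%N -> C k <= v >].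
pose N (v : R) := (\max_(j < (Num.truncn v).+1 | ok v j) j)%N.
have Nmono v v' : v <= v' -> (N v <= N v')%N.
  move=> vv'; apply/bigmax_leqP => j /asboolP okj.
  have jlt : (j < (Num.truncn v').+1)%N.
    by apply: (leq_trans (ltn_ord j)); rewrite ltnS; exact: le_truncn.
  apply: (@leq_bigmax_cond _ _ (fun j : 'I_(Num.truncn v').+1 => j : nat) (Ordinal jlt)).
  by apply/asboolP => k kj; exact: le_trans (okj k kj) vv'.
have mN n : measurable [set v | (n <= N v)%N].
  apply: is_interval_measurable => x y /= nx ny z /andP[xz _].
  exact: leq_trans nx (Nmono _ _ xz).
exists N; split=> [n|k v kN|n].
- rewrite (_ : [set v | N v = n] = [set v | (n <= N v)%N] `\` [set v | (n.+1 <= N v)%N]).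
    exact: measurableD.
  apply/seteqP; split=> v /=; first by move=> <-; split=> //; rewrite ltnn.
  by move=> [nN /negP]; rewrite -leqNgt => Nn; apply/eqP; rewrite eqn_leq Nn.
- have [N0|/asboolP] := bigmax_attained (Num.truncn v).+1 (ok v); last first.
    by move/(_ _ kN); right.
  left; apply/ffunP => a; rewrite ffunE; apply/eqP; rewrite -absz_eq0 -leqn0.
  by move/znorm_leP: kN => /(_ a); rewrite /N N0.
- have [M CM] : exists M : R, forall k, (znorm k <= n)%N -> C k <= M.
    exists (\big[Num.max/0]_(k <- finmap.enum_fset
      (fset_set [set k : Zd d | (znorm k <= n)%N])) C k).
    move=> k kn; apply: le_bigmax_seq => //.
    by rewrite in_fset_set ?inE//; exact: finite_box.
  exists (Num.max n%:R M) => v; rewrite ge_max => /andP[nv Mv].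
  have nlt : (n < (Num.truncn v).+1)%N by rewrite ltnS truncn_ge_nat// (le_trans _ nv).
  apply: (@leq_bigmax_cond _ _ (fun j : 'I_(Num.truncn v).+1 => j : nat) (Ordinal nlt)).
  by apply/asboolP => k kn; exact: le_trans (CM k kn) Mv.
Qed.

End SlowScale.

(** * Scaling of a Pareto variable and an independent companion *)

Section ParetoScaling.
Local Open Scope ereal_scope.
Context (R : realType) disp (T : measurableType disp) (P : probability T R).
Context (alpha : R) (Y : {RV P >-> R}).
Hypothesis hY : pareto P Y alpha.

Let mY : measurable_fun setT Y.
Proof. exact: measurable_funPT. Qed.

Lemma measurable_gt_level (u : R) : measurable [set w | (u < Y w)%R].
Proof.
rewrite (_ : [set w | _] = Y @^-1` `]u, +oo[).
  by rewrite -[X in measurable X]setTI; exact: mY.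
by apply/seteqP; split=> w /=; rewrite in_itv/= andbT.
Qed.

Lemma pareto_gt_max (y : R) : P [set w | (y < Y w)%R] = ((Num.max 1 y) `^ (- alpha))%:E.
Proof.
have [y1|y1] := leP 1%R y; first by rewrite hY.
rewrite powR1; apply/eqP; rewrite eq_le probability_le1/=; last exact: measurable_gt_level.
have <- : P [set w | (1 < Y w)%R] = 1 by rewrite hY// powR1.
apply: le_measure; rewrite ?inE; [exact: measurable_gt_level..|].
by move=> w /=; exact: lt_trans.
Qed.

(** Both sides are finite measures in A, and rays generate the Borel sets; on a ray
    the identity is the multiplicativity of the power function. *)
Lemma pareto_scaling (u : R) (A : set R) : (1 <= u)%R -> measurable A ->
  P ([set w | (u < Y w)%R] `&` [set w | A (Y w / u)%R]) =
  (u `^ (- alpha))%:E * P (Y @^-1` A).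
Proof.
move=> u1 mA; have u0 : (0 < u)%R := lt_le_trans ltr01 u1.
have k0 : (0 <= u `^ (- alpha))%R := powR_ge0 _ _.
have mYu : measurable_fun setT (fun w => Y w / u)%R.
  by apply: measurable_funM => //; exact: measurable_cst.
pose m1 : {measure set R -> \bar R} :=
  image_measure
    (mrestr P (measurable_gt_level u)) mYu.
pose m2 : {measure set R -> \bar R} := mscale (NngNum k0) (distribution P Y).
transitivity (m1 A); first by rewrite /m1 /= /pushforward /mrestr setIC.
transitivity (m2 A); last by rewrite /m2 /= /mscale.
apply: (@measure_unique _ R R (RGenOInfty.G (R := R))
  (fun k => `](- k%:R)%R, +oo[%classic) _ _ _ _ m1 m2) => //.
- exact: RGenOInfty.measurableE.
- move=> _ _ [x ->] [y ->]; exists (Num.max x y).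
  by apply/seteqP; split=> z /=; rewrite !in_itv/= !andbT gt_max => /andP.
- by move=> k; exists (- k%:R)%R.
- apply/seteqP; split=> // x _; exists (Num.truncn `|x|%R).+1 => //=.
  rewrite in_itv/= andbT ltrNl (le_lt_trans _ (truncnS_gt _))//.
  by rewrite -normrN ler_norm.
- move=> _ [y ->]; rewrite /m1 /m2 /= /pushforward /mrestr /mscale /=.
  rewrite (_ : _ `&` _ = [set w | (u * Num.max 1 y < Y w)%R]); last first.
    apply/seteqP; split=> w /=; rewrite !in_itv/= !andbT ltr_pdivlMr// maxr_pMr ?ltW//.
      by move=> [yY uY]; rewrite mulr1 gt_max uY mulrC.
    by rewrite mulr1 gt_max mulrC => /andP[-> ->].
  rewrite pareto_gt_max (_ : distribution P Y _ = P [set w | (y < Y w)%R]); last first.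
    by congr (P _); apply/seteqP; split=> w /=; rewrite in_itv/= andbT.
  rewrite pareto_gt_max max_r; last first.
    by rewrite (le_trans u1)// ler_peMr ?(ltW u0)// le_max lexx.
  by rewrite powRM ?(ltW u0)// le_max ler01.
- move=> k; rewrite /m1 /= /pushforward /mrestr; apply: (@le_lt_trans _ _ 1).
    apply: probability_le1; apply: measurableI; last exact: measurable_gt_level.
    by rewrite -[X in measurable X]setTI; apply: (mYu measurableT).
  exact: ltry.
Qed.

Context d' (T' : measurableType d') (Q : {RV P >-> T'}).
Hypothesis hYQ : independent Y Q.

Let mQ : measurable_fun setT Q.
Proof. exact: measurable_funPT. Qed.

(** The self-similarity of a Pareto variable survives the presence of an
    independent companion, since it is enough to compare the two laws on
    rectangles. *)
Lemma joint_scaling (u : R) (Phi : R * T' -> \bar R) : (1 <= u)%R ->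
  measurable_fun setT Phi -> (forall x, 0 <= Phi x) ->
  \int[P]_(w in [set w | (u < Y w)%R]) Phi (Y w / u, Q w)%R =
  (u `^ (- alpha))%:E * \int[P]_w Phi (Y w, Q w).
Proof.
move=> u1 mPhi Phi0.
have k0 : (0 <= u `^ (- alpha))%R := powR_ge0 _ _.
have mYu : measurable_fun setT (fun w => Y w / u)%R.
  by apply: measurable_funM => //; exact: measurable_cst.
have mYQu : measurable_fun setT (fun w => (Y w / u, Q w)%R).
  exact: measurable_fun_pair.
have mYQ : measurable_fun setT (fun w => (Y w, Q w)).
  exact: measurable_fun_pair.
pose m1 : {measure set (R * T') -> \bar R} :=
  image_measure
    (mrestr P (measurable_gt_level u)) mYQu.
pose m0 : {measure set (R * T') -> \bar R} :=
  image_measure P mYQ.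
pose m2 : {measure set (R * T') -> \bar R} := mscale (NngNum k0) m0.
transitivity (\int[m1]_x Phi x).
  rewrite /m1 /= ge0_integral_pushforward// preimage_setT ge0_integral_mrestr//.
  - exact: measurableT_comp.
  - by move=> w; exact: Phi0.
transitivity (\int[m2]_x Phi x); last first.
  by rewrite ge0_integral_mscale// ge0_integral_pushforward.
apply: eq_measure_integral => A mA _.
apply: (@measure_unique _ R (R * T')%type _ (fun=> setT)
  (measurable_prod_measurableType R T') _ _ _ m1 m2) => //.
- move=> _ _ [A1 mA1 [B1 mB1 <-]] [A2 mA2 [B2 mB2 <-]].
  exists (A1 `&` A2); first exact: measurableI.
  by exists (B1 `&` B2); [exact: measurableI|rewrite setXI].
- by move=> _; exists setT => //; exists setT => //; rewrite setXTT.
- by apply/seteqP; split=> // x _; exists 0%N.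
- move=> _ [A1 mA1 [B1 mB1 <-]].
  rewrite /m1 /m2 /= /pushforward /mscale /mrestr /m0 /= /pushforward.
  pose A' : set R := `]u, +oo[ `&` (fun y => y / u)%R @^-1` A1.
  have mA' : measurable A'.
    apply: measurableI => //; rewrite -[X in measurable X]setTI.
    by apply: measurable_funM => //; exact: measurable_cst.
  rewrite (_ : _ `&` _ = Y @^-1` A' `&` Q @^-1` B1); last first.
    apply/seteqP; split=> w /=; rewrite /A' /= in_itv/= andbT.
      by move=> [[AY BQ] uY].
    by move=> [[uY AY] BQ].
  rewrite hYQ// (_ : Y @^-1` A' =
      [set w | (u < Y w)%R] `&` [set w | A1 (Y w / u)%R]); last first.
    by apply/seteqP; split=> w /=; rewrite /A' /= in_itv/= andbT.
  by rewrite pareto_scaling// -muleA -hYQ.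
- move=> _; apply: (@le_lt_trans _ _ 1); last exact: ltry.
  rewrite /m1 /= /pushforward /mrestr preimage_setT setTI.
  exact: probability_le1 (measurable_gt_level u).
Qed.

Lemma pareto_notgt1 : P (~` [set w | (1 < Y w)%R]) = 0.
Proof.
rewrite probability_setC; last exact: measurable_gt_level.
by rewrite hY// powR1 subee.
Qed.

Lemma ae_pareto_gt1 : {ae P, forall w, (1 < Y w)%R}.
Proof.
exists (~` [set w | (1 < Y w)%R]); split.
- exact: measurableC (measurable_gt_level 1).
- exact: pareto_notgt1.
- by apply: subsetC => w.
Qed.

Lemma pareto_mul_le (c : R) : (0 < alpha)%R ->
  P [set w | (1 < `|Y w * c|)%R] <= (`|c| `^ alpha)%:E.
Proof.
move=> alpha0.
have mA : measurable [set w | (1 < `|Y w * c|)%R].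
  rewrite -[X in measurable X]setTI; apply: measurable_fun_ltr => //.
  by apply: measurableT_comp => //; apply: measurable_funM => //; exact: measurable_cst.
have [->|c0] := eqVneq c 0%R.
  rewrite (_ : [set w | _] = set0) ?measure0 ?lee_fin ?powR_ge0//.
  by apply/seteqP; split=> w //=; rewrite mulr0 normr0 ltr10.
have nc0 : (0 < `|c|)%R by rewrite normr_gt0.
have [c1|c1] := leP 1%R `|c|%R.
  apply: (le_trans (probability_le1 _ mA)); rewrite lee_fin.
  by rewrite -[leLHS](powRr0 `|c|%R) ler_powR// ltW.
have mY1 := measurableC (measurable_gt_level 1).
apply: (@le_trans _ _ (P ([set w | (`|c|^-1 < Y w)%R] `|` ~` [set w | (1 < Y w)%R]))).
  apply: le_measure; rewrite ?inE//.
    by apply: measurableU => //; exact: measurable_gt_level.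
  move=> w /=; rewrite normrM => Yc.
  have [Y1|] := boolP (1 < Y w)%R; [left|by move/negP; right].
  by move: Yc; rewrite gtr0_norm ?(lt_trans ltr01)// -ltr_pdivrMr// div1r.
apply: (le_trans (measureU2 _ _ mY1)); first exact: measurable_gt_level.
rewrite [X in _ + X]pareto_notgt1 adde0 [leLHS]hY; last first.
  by rewrite invr_ge1 ?unitfE ?normr_eq0// ltW.
by rewrite lee_fin -powR_inv1 ?(ltW nc0)// -powRrM mulrNN mul1r.
Qed.

(** Integrates [pareto_mul_le] over the law of Q, using that the law of (Q, Y) is
    the product of the marginal laws. *)
Lemma pareto_mul_indep_le (q : T' -> R) : (0 < alpha)%R -> measurable_fun setT q ->
  P [set w | (1 < `|Y w * q (Q w)|)%R] <= \int[P]_w (`|q (Q w)| `^ alpha)%:E.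
Proof.
move=> alpha0 mq.
have mQY : measurable_fun setT (fun w => (Q w, Y w)).
  exact: measurable_fun_pair.
pose m' : {measure set (T' * R) -> \bar R} :=
  image_measure P mQY.
pose A : set (T' * R) := [set x | (1 < `|x.2 * q x.1|)%R].
have mA : measurable A.
  rewrite -[X in measurable X]setTI; apply: measurable_fun_ltr => //.
  apply: measurableT_comp => //; apply: measurable_funM => //.
  exact: measurableT_comp.
have prodE := @product_measure_unique _ _ T' R R (distribution P Q) (distribution P Y) m'.
have -> : P [set w | (1 < `|Y w * q (Q w)|)%R] = m' A by [].
rewrite -prodE//; last first.
  by move=> B C mB mC; rewrite muleC -[RHS]hYQ// setIC.
rewrite -(ge0_integral_distribution Q (f := fun x => (`|q x| `^ alpha)%:E)); last 2 first.
- apply/measurable_EFinP.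
  apply: (@measurableT_comp _ _ _ _ _ _ (fun r : R => (r `^ alpha)%R)) => //.
  exact: measurableT_comp.
- by move=> x; rewrite lee_fin powR_ge0.
have mpow : measurable_fun setT (fun x => (`|q x| `^ alpha)%:E).
  apply/measurable_EFinP.
  apply: (@measurableT_comp _ _ _ _ _ _ (fun r : R => (r `^ alpha)%R)) => //.
  exact: measurableT_comp.
apply: ge0_le_integral => //.
- exact: measurable_fun_xsection.
- move=> x _ /=; apply: le_trans (pareto_mul_le (q x) alpha0).
  rewrite /distribution /pushforward (_ : Y @^-1` _ = [set w | (1 < `|Y w * q x|)%R])//.
  by apply/seteqP; split=> w /=; rewrite /xsection/= inE.
Qed.

End ParetoScaling.

(** * Paths vanishing at infinity and their exceedances *)

Section PathSpace.
Context (R : realType) (d : nat).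

Lemma measurable_translate (k : Zd d) :
  measurable_fun setT (@translate R d k).
Proof. by apply: measurable_paths => i; exact: measurable_coordinate. Qed.

Lemma measurable_window (m : nat) :
  measurable_fun setT (@window R d m).
Proof. by apply: measurable_paths => i; exact: measurable_coordinate. Qed.

Lemma measurable_abs_gt (I : Type) (i : I) (u : R) :
  measurable [set x : paths I R | u < `|x i|].
Proof.
rewrite -[X in measurable X]setTI; apply: measurable_fun_ltr => //.
by apply: measurableT_comp => //; exact: measurable_coordinate.
Qed.

Lemma bounded_exc_finite (x : paths (Zd d) R) (n : nat) :
  (forall k, (n < znorm k)%N -> `|x k| <= 1) -> finite_set (exc x).
Proof.
move=> xn; apply: sub_finite_set (finite_box d n) => k /= x1.
by rewrite leqNgt; apply: contraL x1 => /xn; rewrite -leNgt.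
Qed.

Lemma finite_setZ_bounded (A : set (Zd d)) : finite_set A ->
  exists n, forall k, A k -> (znorm k <= n)%N.
Proof.
move=> finA; exists (\max_(k <- finmap.enum_fset (fset_set A)) znorm k)%N => k Ak.
by apply: leq_bigmax_seq => //; rewrite in_fset_set ?inE.
Qed.

Lemma measurable_E0 : measurable (@E0 R d).
Proof.
have mB n : measurable
    (\bigcup_(k in [set: Zd d]) [set x : paths (Zd d) R | (n < znorm k)%N && (1 < `|x k|)]).
  apply: countable_bigcupT_measurable => // k; case: (n < znorm k)%N => /=.
    exact: measurable_abs_gt.
  by rewrite (_ : [set _ | _] = set0)//; apply/seteqP; split.
rewrite (_ : @E0 R d = [set x : paths (Zd d) R | 1 < `|x 0|] `&`
  \bigcup_n ~` (\bigcup_(k in [set: Zd d])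
     [set x : paths (Zd d) R | (n < znorm k)%N && (1 < `|x k|)])).
  apply: measurableI; first exact: measurable_abs_gt.
  by apply: bigcupT_measurable => n; exact: measurableC.
apply/seteqP; split=> [x [x0 finx]|x [x0 [n _ xn]]]; split=> //.
  have [n xn] := finite_setZ_bounded finx; exists n => //= -[k _ /= /andP[nk xk]].
  by have := xn k xk; rewrite leqNgt nk.
apply: (bounded_exc_finite (n := n)) => k nk; rewrite leNgt; apply/negP => xk.
by apply: xn; exists k => //=; rewrite nk xk.
Qed.

Lemma l0_scale (c : R) (x : paths (Zd d) R) : l0 x -> l0 (fun i => c * x i).
Proof.
move=> x0 e e0; have [->|c0] := eqVneq c 0.
  by exists 0%N => i _; rewrite mul0r normr0.
have nc0 : 0 < `|c| by rewrite normr_gt0.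
have [n xn] := x0 (e / `|c|) (divr_gt0 e0 nc0); exists n => i /xn.
by rewrite normrM ltr_pdivlMr// mulrC.
Qed.

Lemma l0_exc_finite (x : paths (Zd d) R) : l0 x -> finite_set (exc x).
Proof.
move=> /(_ 1 ltr01)[n xn]; apply: (bounded_exc_finite (n := n)) => k nk.
by apply: ltW; apply: xn; exact: ltnW.
Qed.

Lemma l0_translate (k : Zd d) (x : paths (Zd d) R) : l0 x -> l0 (translate k x).
Proof.
move=> x0 e /x0[n xn]; exists (n + znorm k)%N => i ni; apply: xn.
have := leq_znormD (i + k) (- k); rewrite addrK.
have -> : znorm (- k) = znorm k.
  by apply: eq_bigr => a _; rewrite ffunE abszN.
by move=> ik; rewrite -(leq_add2r (znorm k)); exact: leq_trans ni ik.
Qed.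

Lemma translate_exc_E0 (k : Zd d) (x : paths (Zd d) R) :
  l0 x -> exc x k -> E0 (translate k x).
Proof.
move=> x0 xk; split; first by rewrite /translate add0r.
by apply: l0_exc_finite; exact: l0_translate.
Qed.

Lemma counting_esum (A : set (Zd d)) : finite_set A ->
  counting A = (\esum_(k in A) 1)%E :> \bar R.
Proof.
move=> finA; rewrite /counting asboolT// esum_fset//.
rewrite fsbig_finite//= big_const_seq count_predT.
set n := size _; elim: n => //= n <-.
by rewrite -EFinD -natr1 addrC.
Qed.

Definition E0_point : paths (Zd d) R := fun i => if i == 0 then 2 else 0.

Lemma E0_pointP : E0 E0_point.
Proof.
split; first by rewrite /E0_point eqxx normr_nat ltr1n.
apply: (bounded_exc_finite (n := 0)) => k k0; rewrite /E0_point.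
by case: eqP k0 => [->|_ _]; rewrite ?znorm0// normr0.
Qed.

(** A retraction onto E0, which turns a process that lies in E0 almost surely into
    one that lies there at every outcome. *)
Definition to_E0 (x : paths (Zd d) R) : paths (Zd d) R :=
  if x \in @E0 R d then x else E0_point.

Lemma to_E0P x : E0 (to_E0 x).
Proof. by rewrite /to_E0; case: ifPn => [|_]; [rewrite inE|exact: E0_pointP]. Qed.

Lemma to_E0_id x : E0 x -> to_E0 x = x.
Proof. by move=> x0; rewrite /to_E0 ifT// inE. Qed.

Lemma measurable_to_E0 : measurable_fun setT to_E0.
Proof.
apply: measurable_fun_ifT => //=.
apply: (measurable_fun_bool true); rewrite setTI preimage_mem_true.
exact: measurable_E0.
Qed.

End PathSpace.

(** * The exceedance-stationary process of the cluster YQ *)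

Section Cluster.
Local Open Scope ereal_scope.
Context (R : realType) (d : nat) disp (T : measurableType disp) (P : probability T R).
Context (alpha : R) (Q : {RV P >-> paths (Zd d) R}) (Y : {RV P >-> R}).
Hypothesis halpha : (0 < alpha)%R.
Hypothesis hQ0 : forall w, l0 (Q w).
Hypothesis hQ1 : {ae P, forall w, supnorm (Q w) = 1%E}.
Hypothesis hQalpha :
  \int[P]_w (\esum_(k in [set: Zd d]) (`|Q w k| `^ alpha)%:E) < +oo.
Hypothesis hY : pareto P Y alpha.
Hypothesis hYQ : independent Y Q.

Local Notation Z := (fun w => (fun i => Y w * Q w i)%R : paths (Zd d) R).

Lemma measurable_Q k : measurable_fun setT (fun w => Q w k).
Proof. by apply: measurable_path_comp; exact: measurable_funPT. Qed.

Lemma measurable_Z : measurable_fun setT Z.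
Proof.
apply: measurable_paths => i.
by apply: measurable_funM; [exact: measurable_funPT|exact: measurable_Q].
Qed.

Lemma measurable_excZ k : measurable [set w | exc (Z w) k].
Proof.
have := measurable_Z measurableT (measurable_abs_gt k 1).
by rewrite setTI.
Qed.

Lemma l0_Z w : l0 (Z w).
Proof. exact: l0_scale. Qed.

Lemma mean_excE : mean_exc P Z = \int[P]_w (\esum_(k in exc (Z w)) 1).
Proof.
apply: eq_integral => w _; rewrite counting_esum//.
exact: l0_exc_finite (l0_Z w).
Qed.

Lemma mean_exc_sum : mean_exc P Z =
  \esum_(k in [set: Zd d]) P [set w | (1 < `|Y w * Q w k|)%R].
Proof.
rewrite mean_excE (@integral_random_esum _ _ _ _ P (fun w => exc (Z w))
  (fun _ _ => 1))//; last exact: measurable_excZ.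
apply: eq_esum => k _; rewrite integral_cst ?mul1e//.
exact: measurable_excZ.
Qed.

Lemma mean_exc_lty : mean_exc P Z < +oo.
Proof.
apply: le_lt_trans hQalpha; rewrite mean_exc_sum integral_esum; last 2 first.
- move=> k; apply/measurable_EFinP.
  apply: (@measurableT_comp _ _ _ _ _ _ (fun r : R => (r `^ alpha)%R)) => //.
  by apply: measurableT_comp => //; exact: measurable_Q.
- by move=> k w; rewrite lee_fin powR_ge0.
apply: le_esum => k _.
exact: (pareto_mul_indep_le hY hYQ halpha (measurable_coordinate k)).
Qed.

Lemma ae_Q_le1 : {ae P, forall w, forall k, (`|Q w k| <= 1)%R}.
Proof.
apply: filterS hQ1 => w Qw k; rewrite -lee_fin -Qw.
by apply: ereal_sup_ubound; exists k.
Qed.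

(** The supremum of |Q| is 1 and Y exceeds 1, so some coordinate of YQ exceeds 1. *)
Lemma mean_exc_ge1 : 1 <= mean_exc P Z.
Proof.
pose A := \bigcup_(k in [set: Zd d]) [set w | exc (Z w) k].
have mA : measurable A.
  by apply: countable_bigcupT_measurable => // k; exact: measurable_excZ.
have PA : P A = 1.
  have nA : P.-negligible (~` A).
    have : {ae P, forall w, A w}.
      apply: filterS2 hQ1 (ae_pareto_gt1 hY) => w Qw Yw.
      have Y0 : (0 < Y w)%R := lt_trans ltr01 Yw.
      have : ((Y w)^-1)%:E < supnorm (Q w).
        by rewrite Qw lte_fin invf_lt1.
      move=> /ereal_sup_gt[_ [k _ <-]]; rewrite lte_fin => Yk.
      exists k => //; rewrite /exc /= normrM gtr0_norm//.
      by rewrite -ltr_pdivrMl// mulr1.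
    by [].
  have PnA : P (~` A) = 0 by apply/negligibleP => //; exact: measurableC.
  have := probability_setC P mA; rewrite PnA => /esym/eqP.
  by rewrite sube_eq ?fin_num_measure// add0e => /eqP.
rewrite -PA mean_excE -[A]setIT -integral_indic//.
have mcard : measurable_fun setT (fun w => \esum_(k in exc (Z w)) (1 : \bar R)).
  apply: (@measurable_random_esum _ _ _ _ (fun w => exc (Z w)) (fun _ _ => 1)) => //.
  exact: measurable_excZ.
apply: ge0_le_integral => //.
- by apply/measurable_EFinP; exact: measurable_indic.
move=> w _; rewrite indicE; case: (boolP (w \in A)) => [|_]; last first.
  by apply: esum_ge0 => k _; exact: lee01.
rewrite inE => -[k _ Zk]; apply: ereal_sup_ubound.
exists [set k]; last by rewrite fsbig_set1.
by split; [exact: finite_set1|move=> _ ->].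
Qed.

Lemma mean_exc_fin : mean_exc P Z \is a fin_num.
Proof. by rewrite ge0_fin_numE ?mean_exc_lty// (le_trans lee01 mean_exc_ge1). Qed.

Lemma exists_exc_stationary : exists (disp' : measure_display)
  (T' : measurableType disp') (P' : probability T' R)
  (W : {RV P' >-> paths (Zd d) R}), exc_stationary_process P Z W.
Proof.
have [||nu nuE] := @cluster_law R _ T P _ (paths (Zd d) R) (Zd d) (fun w => exc (Z w))
  (fun k w => translate k (Z w)) measurable_excZ
  (fun k => measurableT_comp (measurable_translate k) measurable_Z).
- by rewrite -mean_excE gt_eqF// (lt_le_trans lte01 mean_exc_ge1).
- by rewrite -mean_excE mean_exc_lty.
exists _, (paths (Zd d) R), nu, (mfun_Sub (mem_set (@measurable_to_E0 R d))).
split=> [x|h mh h0]; first exact: to_E0P.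
pose h' : paths (Zd d) R -> R := (h \_ (@E0 R d)) \o (@to_E0 R d).
have h'E x : h' x = h (to_E0 x).
  by rewrite /h' /= patchE ifT// inE; exact: to_E0P.
under eq_integral do rewrite /= -h'E.
rewrite nuE; last 2 first.
- apply/measurable_EFinP; apply: measurableT_comp (@measurable_to_E0 R d).
  exact: ((measurable_restrictT _ (@measurable_E0 R d)).1 mh).
- by move=> x; rewrite lee_fin h'E h0//; exact: to_E0P.
rewrite -mean_excE; congr (_ * _); apply: eq_integral => w _.
apply: eq_esum => k Zk; rewrite h'E to_E0_id//.
by apply: translate_exc_E0 => //; exact: l0_Z.
Qed.

End Cluster.

(** * Conditional laws *)

Section CondLaw.
Local Open Scope ereal_scope.
Context (R : realType) disp (T : measurableType disp) (P : probability T R).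

Lemma cond_law_measure disp' (T' : measurableType disp') (A : set T) (X : T -> T') :
  measurable A -> 0 < P A -> measurable_fun setT X ->
  exists2 nu : {measure set T' -> \bar R}, cond_law P A X = nu &
  forall f : T' -> \bar R, measurable_fun setT f -> (forall x, 0 <= f x) ->
  \int[nu]_x f x = (P A)^-1 * \int[P]_(w in A) f (X w).
Proof.
move=> mA PA mX.
have finPA : P A \is a fin_num by exact: fin_num_measure.
have PAV : (P A)^-1 = ((fine (P A))^-1)%:E.
  by rewrite -[in LHS](fineK finPA) inver fine_eq0// gt_eqF.
have k0 : (0 <= (fine (P A))^-1)%R by rewrite invr_ge0 fine_ge0// ltW.
pose nu : {measure set T' -> \bar R} :=
  image_measure (mrestr P mA) mX.
exists (mscale (NngNum k0) nu) => [|f mf f0].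
  apply/funext => B; rewrite /cond_law PAV muleC setIC.
  by [].
rewrite ge0_integral_mscale//= PAV; congr (_ * _).
rewrite ge0_integral_pushforward// preimage_setT ge0_integral_mrestr//.
- exact: measurableT_comp.
- by move=> x; exact: f0.
Qed.

(** In the tail of the wrapped field the normalising constants and the power of u
    appear in both the numerator and the denominator; this cancels them. *)
Lemma inve_ratio (r : R) (a b : \bar R) : (0 < r)%R ->
  (r%:E * b)^-1 * (r%:E * a) = b^-1 * a.
Proof.
move=> r0; rewrite inveM.
  by rewrite muleACA mulVe ?mul1e// eqe gt_eqF.
case: b => [s| |] //=; rewrite gt_eqF//=.
by apply/implyP => _; exact: ltW.
Qed.

End CondLaw.

(** * A stationary field built from one cluster wrapped around a torus *)

Section Torus.
Local Open Scope ereal_scope.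
Context (R : realType) (d : nat) disp (T : measurableType disp) (P : probability T R).
Context (alpha : R) (Q : {RV P >-> paths (Zd d) R}) (Y : {RV P >-> R}).
Hypothesis halpha : (0 < alpha)%R.
Hypothesis hQ0 : forall w, l0 (Q w).
Hypothesis hQ1 : {ae P, forall w, supnorm (Q w) = 1%E}.
Hypothesis hQalpha :
  \int[P]_w (\esum_(k in [set: Zd d]) (`|Q w k| `^ alpha)%:E) < +oo.
Hypothesis hY : pareto P Y alpha.
Hypothesis hYQ : independent Y Q.

Local Notation Z := (fun w => (fun i => Y w * Q w i)%R : paths (Zd d) R).

Definition torus (n : nat) (v : R) (q : paths (Zd d) R) (k : Zd d) : paths (Zd d) R :=
  fun i => (v * q (wrap n (i + k)))%R.

Lemma measurable_torus (N : R -> nat) d' (T' : measurableType d')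
    (c v : T' -> R) (q : T' -> paths (Zd d) R) (k : Zd d) :
  (forall n, measurable [set r | N r = n]) -> measurable_fun setT c ->
  measurable_fun setT v -> measurable_fun setT q ->
  measurable_fun setT (fun x => torus (N (c x)) (v x) (q x) k).
Proof.
move=> mN mc mv mq; apply: measurable_paths => i.
apply: measurable_funM => //.
apply: (@measurable_countable_case nat _ T' _ R (fun x => N (c x))
  (fun n x => q x (wrap n (i + k)%R))) => n; last exact: measurable_path_comp.
by have := mc measurableT _ (mN n); rewrite setTI.
Qed.

Lemma measurable_scale_box (N : R -> nat) d' (T' : measurableType d')
    (c : T' -> R) (n : nat) :
  (forall n, measurable [set r | N r = n]) -> measurable_fun setT c ->
  measurable [set x | (n <= N (c x))%N].
Proof.
move=> mN mc; rewrite (_ : [set x | _] =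
   c @^-1` (\bigcup_(j in [set j | (n <= j)%N]) [set r | N r = j])).
  rewrite -[X in measurable X]setTI; apply: mc => //.
  exact: bigcup_measurable.
by apply/seteqP; split=> [x nx|x [j /= nj ->]//]; exists (N (c x)).
Qed.

(** With C_k = 1 + 2^(p_k/alpha), p_k the rank of k in an enumeration of the
    lattice, the event |k| <= N(Y) forces Y > 2^(p_k/alpha) when k is not 0, which
    has probability 2^-p_k. These probabilities are summable over k. *)
Lemma exists_torus_scale : exists N : R -> nat,
  [/\ forall n, measurable [set v | N v = n],
      \int[P]_w (\esum_(k in [set k : Zd d | (znorm k <= N (Y w))%N]) 1) < +oo &
      forall n, exists V : R, forall v, (V <= v)%R -> (n <= N v)%N].
Proof.
pose c (k : Zd d) : R := ((2 ^ pickle k)%:R `^ alpha^-1)%R.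
have c1 k : (1 <= c k)%R.
  rewrite -(powRr0 (2 ^ pickle k)%:R) ler_powR ?invr_ge0 ?(ltW halpha)//.
  by rewrite ler1n expn_gt0.
have [N [mN Nc Ninf]] := @exists_slow_scale R d (fun k => 1 + c k)%R.
exists N; split=> //.
have mbox k : measurable [set w | (znorm (k : Zd d) <= N (Y w))%N].
  by apply: measurable_scale_box => //; exact: measurable_funPT.
rewrite (@integral_random_esum _ _ _ _ P
  (fun w => [set k : Zd d | (znorm k <= N (Y w))%N]) (fun _ _ => 1))//.
(* K is the smallest constant for which the bound below holds at k = 0, where the
   probability is only known to be at most 1 *)
pose K : R := (2 ^ (pickle (0%R : Zd d)).+1)%:R.
have Kk (k : Zd d) : \int[P]_(w in [set w | (znorm k <= N (Y w))%N]) 1 <=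
    (K / (2 ^ (pickle k).+1)%:R)%:E.
  rewrite integral_cst// mul1e.
  have [->|k0] := eqVneq k 0%R.
    by rewrite divff ?pnatr_eq0 ?expn_eq0//; exact: probability_le1.
  apply: (@le_trans _ _ (P [set w | (c k < Y w)%R])).
    apply: le_measure; rewrite ?inE//; first exact: measurable_gt_level.
    move=> w /Nc[/eqP|/=]; first by rewrite (negPf k0).
    by apply: lt_le_trans; rewrite ltrDr.
  rewrite hY// lee_fin /c -powRrM mulrN mulVf ?gt_eqF// powR_inv1 ?ler0n//.
  rewrite /K !expnS !natrM invfM mulrACA divff ?pnatr_eq0// mul1r.
  by rewrite ler_peMl ?invr_ge0 ?ler0n// ler1n expn_gt0.
apply: (@le_lt_trans _ _ (\esum_(k in [set: Zd d]) (K / (2 ^ (pickle k).+1)%:R)%:E)).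
  by apply: le_esum => k _; exact: Kk.
rewrite esum_nneseries; last by move=> k; rewrite lee_fin divr_ge0 ?ler0n.
have K0 : (0 <= K)%R by rewrite ler0n.
apply: (@le_lt_trans _ _ (0 + K%:E)); last by rewrite add0e ltry.
have geom : \sum_(n <oo) (K / (2 ^ n.+1)%:R)%:E <= 0 + K%:E.
  have := @epsilon_trick R (fun=> 0) K xpredT (fun=> lexx 0) K0.
  rewrite [X in _ <= X + _ -> _]eseries0//.
  by under eq_eseriesr do rewrite add0e.
apply: le_trans geom; apply: lee_nneseries => n _.
  by case: pickle_inv => //= k; rewrite lee_fin divr_ge0 ?ler0n.
case E : (pickle_inv n) => [k|] /=; last first.
  by rewrite lee_fin divr_ge0 ?ler0n.
by have := @pickle_invK (Zd d) n; rewrite /ocancel E /= => ->.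
Qed.

Context (N : R -> nat).
Hypothesis mN : forall n, measurable [set v | N v = n].
Hypothesis Nfin :
  \int[P]_w (\esum_(k in [set k : Zd d | (znorm k <= N (Y w))%N]) 1) < +oo.
Hypothesis Ninf : forall n, exists V : R, forall v, (V <= v)%R -> (n <= N v)%N.

Let m := \int[P]_w (\esum_(k in [set k : Zd d | (znorm k <= N (Y w))%N]) 1).

Let mQ : measurable_fun setT Q.
Proof. exact: measurable_funPT. Qed.

Let mY : measurable_fun setT Y.
Proof. exact: measurable_funPT. Qed.

Let mbox (k : Zd d) : measurable [set w | (znorm k <= N (Y w))%N].
Proof. exact: measurable_scale_box. Qed.

Let mtorus k : measurable_fun setT (fun w => torus (N (Y w)) (Y w) (Q w) k).
Proof. exact: measurable_torus. Qed.

Lemma torus_mass_gt0 : 0 < m.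
Proof.
apply: (@lt_le_trans _ _ 1); first exact: lte01.
rewrite -(@probability_setT _ _ _ P) -[X in X <= _]mul1e -integral_cst//.
apply: ge0_le_integral => //.
- by apply: (@measurable_random_esum _ _ _ _
    (fun w => [set k : Zd d | (znorm k <= N (Y w))%N]) (fun _ _ => 1)).
move=> w _; apply: ereal_sup_ubound; exists [set 0%R]; last by rewrite fsbig_set1.
by split; [exact: finite_set1|move=> _ -> /=; rewrite znorm0].
Qed.

(** The law of the wrapped cluster, read off a uniform point of the torus, after
    (Y, Q) has been reweighted by the volume of the torus: the weight and the
    uniform density cancel, leaving an unweighted sum over the torus. *)
Definition torus_law (mu : probability (paths (Zd d) R) R) :=
  forall h : paths (Zd d) R -> \bar R, measurable_fun setT h -> (forall x, 0 <= h x) ->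
  \int[mu]_x h x = m^-1 * \int[P]_w
    (\esum_(k in [set k | (znorm k <= N (Y w))%N]) h (torus (N (Y w)) (Y w) (Q w) k)).

Lemma exists_torus_law : exists mu, torus_law mu.
Proof.
by apply: cluster_law => //; rewrite -/m gt_eqF// torus_mass_gt0.
Qed.

Context (mu : probability (paths (Zd d) R) R).
Hypothesis muE : torus_law mu.

Lemma torus_law_stationary (t : Zd d) (A : set (paths (Zd d) R)) : measurable A ->
  mu (translate t @^-1` A) = mu A.
Proof.
move=> mA.
have muI B : measurable B -> mu B = \int[mu]_x (\1_B x)%:E.
  by move=> mB; rewrite integral_indic// setIT.
have mtA : measurable (translate t @^-1` A).
  by rewrite -[X in measurable X]setTI; apply: (@measurable_translate R d t).
have i0 (B : set (paths (Zd d) R)) x : 0 <= (\1_B x : R)%:E by rewrite lee_fin.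
have mi B : measurable B -> measurable_fun setT (fun x : paths (Zd d) R => (\1_B x : R)%:E).
  by move=> mB; apply/measurable_EFinP; exact: measurable_indic.
rewrite (muI _ mtA) (muI _ mA) (muE (mi _ mtA) (i0 _)) (muE (mi _ mA) (i0 _)).
apply: (f_equal (fun r => m^-1 * r)); apply: eq_integral => w _.
rewrite [RHS](reindex_esum _ _ _ _ (@wrap_bij d (N (Y w)) t)).
apply: eq_esum => k kN; congr (_%:E); rewrite !indicE; congr ((_ : bool)%:R).
have -> : torus (N (Y w)) (Y w) (Q w) (wrap (N (Y w)) (k + t)%R) =
    translate t (torus (N (Y w)) (Y w) (Q w) k).
  by apply/funext => i; rewrite /torus /translate wrapDr (addrC k) addrA.
by apply/idP/idP; rewrite !inE.
Qed.

Lemma exceed_scaled (u v q : R) : (0 < u)%R ->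
  (1 < `|v / u * q|)%R = (u < `|v * q|)%R.
Proof.
by move=> u0; rewrite mulrAC (normrM (v * q)%R) [`|u^-1|%R]gtr0_norm ?invr_gt0//
  ltr_pdivlMr// mul1r.
Qed.

Lemma exceed_none (u v q : R) : (0 < v)%R -> (v <= u)%R -> (`|q| <= 1)%R ->
  (u < `|v * q|)%R = false.
Proof.
move=> v0 vu q1; apply/negbTE; rewrite -leNgt normrM gtr0_norm//.
by apply: le_trans vu; rewrite ler_piMr ?(ltW v0).
Qed.

(** The sum over exceedances that describes the tail of the wrapped field at level
    u, as a function of a pair with the law of (Y/u, Q) given Y > u; the torus still
    has the size prescribed by the unscaled value u * x.1. *)
Definition tail_sum (u : R) (f : paths (Zd d) R -> \bar R)
    (x : R * paths (Zd d) R) : \bar R :=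
  \esum_(k in [set k | (znorm k <= N (u * x.1)%R)%N && (1 < `|x.1 * x.2 k|)%R])
    f (torus (N (u * x.1)%R) x.1 x.2 k).

Lemma tail_sum_ge0 u f x : (forall y, 0 <= f y) -> 0 <= tail_sum u f x.
Proof. by move=> f0; exact: esum_ge0. Qed.

Lemma measurable_tail_sum (u : R) (f : paths (Zd d) R -> \bar R) :
  measurable_fun setT f -> (forall x, 0 <= f x) -> measurable_fun setT (tail_sum u f).
Proof.
move=> mf f0.
have m1 : measurable_fun setT (fst : R * paths (Zd d) R -> R) by exact: measurable_fst.
have m2 : measurable_fun setT (snd : R * paths (Zd d) R -> paths (Zd d) R).
  exact: measurable_snd.
have mu1 : measurable_fun setT (fun x : R * paths (Zd d) R => (u * x.1)%R).
  by apply: measurable_funM => //; exact: measurable_cst.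
apply: (@measurable_random_esum _ _ _ _
  (fun x : R * paths (Zd d) R => [set k : Zd d | (znorm k <= N (u * x.1)%R)%N &&
     (1 < `|x.1 * x.2 k|)%R])
  (fun k x => f (torus (N (u * x.1)%R) x.1 x.2 k))) => // k.
  rewrite (_ : [set w | _] =
    [set x : R * paths (Zd d) R | (znorm k <= N (u * x.1)%R)%N] `&`
    [set x : R * paths (Zd d) R | (1 < `|x.1 * x.2 k|)%R]); last first.
    by apply/seteqP; split=> x /= => [/andP[]|[-> ->]].
  apply: measurableI; first exact: (measurable_scale_box _ mN mu1).
  rewrite -[X in measurable X]setTI; apply: measurable_fun_ltr => //.
  apply: measurableT_comp => //; apply: measurable_funM => //.
  exact: measurable_path_comp.
apply: measurableT_comp => //; exact: measurable_torus.
Qed.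

(** When Y > u the exceedances of the wrapped cluster above u are those of (Y/u) Q
    above 1, and [joint_scaling] applies; when 1 < Y <= u there are none, since
    |Q| <= 1. *)
Lemma torus_tail_integral (u : R) (f : paths (Zd d) R -> \bar R) : (1 <= u)%R ->
  measurable_fun setT f -> (forall x, 0 <= f x) ->
  \int[mu]_(x in [set x : paths (Zd d) R | (u < `|x 0%R|)%R]) f (fun i => u^-1 * x i)%R =
  m^-1 * ((u `^ (- alpha))%:E * \int[P]_w tail_sum u f (Y w, Q w)).
Proof.
move=> u1 mf f0; have u0 : (0 < u)%R := lt_le_trans ltr01 u1.
have mscale : measurable_fun setT
    (fun x : paths (Zd d) R => (fun i => u^-1 * x i)%R : paths (Zd d) R).
  apply: measurable_paths => i; apply: measurable_funM; first exact: measurable_cst.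
  exact: measurable_coordinate.
have mfs : measurable_fun setT (fun x : paths (Zd d) R => f (fun i => u^-1 * x i)%R).
  exact: (measurableT_comp mf mscale).
have mYu : measurable_fun setT (fun w => (Y w / u, Q w)%R).
  apply: measurable_fun_pair => //.
  exact: (measurable_funM mY (measurable_cst _)).
rewrite integral_mkcond.
set h := _ \_ _.
have mh : measurable_fun setT h.
  by apply: measurable_patch => //; exact: measurable_abs_gt.
have h0 x : 0 <= h x by rewrite /h patchE; case: ifP.
rewrite (muE mh h0) -(joint_scaling hY hYQ u1 (measurable_tail_sum u mf f0)); last first.
  by move=> x; exact: tail_sum_ge0.
apply: (f_equal (fun r => m^-1 * r)).
rewrite [RHS]integral_mkcond; apply: ge0_ae_eq_integral => //.
- apply: (@measurable_random_esum _ _ _ _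
    (fun w => [set k : Zd d | (znorm k <= N (Y w))%N])
    (fun k w => h (torus (N (Y w)) (Y w) (Q w) k))) => // k.
  exact: (measurableT_comp mh (mtorus k)).
- apply: measurable_patch; first exact: measurable_gt_level.
  exact: (measurableT_comp (measurable_tail_sum u mf f0) mYu).
- by move=> w _; exact: esum_ge0.
- by move=> w _; rewrite patchE; case: ifP => // _; exact: tail_sum_ge0.
apply: filterS2 (ae_pareto_gt1 hY) (ae_Q_le1 hQ1) => w Y1 Qle1 _.
have Y0 : (0 < Y w)%R := lt_trans ltr01 Y1.
have torus0 k : (znorm k <= N (Y w))%N ->
    torus (N (Y w)) (Y w) (Q w) k 0%R = (Y w * Q w k)%R.
  by move=> kN; rewrite /torus add0r wrap_id.
rewrite patchE; case: ifPn => [|]; rewrite ?inE ?notin_setE/= => uY; last first.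
  apply: esum1 => k /torus0 tk; rewrite /h patchE ifF//.
  by apply/negbTE; rewrite notin_setE/= tk exceed_none// leNgt; exact/negP.
rewrite /tail_sum /= [(u * _)%R]mulrC divfK ?gt_eqF//.
rewrite (_ : [set k | _ && _] = [set k | (znorm k <= N (Y w))%N] `&`
  [set k | (1 < `|Y w / u * Q w k|)%R]); last first.
  by apply/seteqP; split=> k /= => [/andP[]|[-> ->]].
rewrite esum_mkcondr; apply: eq_esum => k /torus0 tk.
rewrite /h patchE; congr (if _ then f _ else _).
  by apply/idP/idP; rewrite !inE/= tk exceed_scaled.
by apply/funext => i; rewrite /torus mulrA [(u^-1 * _)%R]mulrC.
Qed.

(** Once the torus is larger than e(Z) and the window around each of its points,
    wrapping is invisible. *)
Lemma tail_sum_near (n0 : nat) (F : paths (box d n0) R -> \bar R) (u_ : R^nat) w :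
  u_ n @[n --> \oo] --> +oo%R -> (0 < Y w)%R ->
  \forall n \near \oo, tail_sum (u_ n) (F \o window n0) (Y w, Q w) =
    \esum_(k in exc (Z w)) F (window n0 (translate k (Z w))).
Proof.
move=> uoo Y0; have [n1 en1] := finite_setZ_bounded (l0_exc_finite (l0_Z Y hQ0 w)).
have [V NV] := Ninf (n1 + n0)%N.
have /cvgryPge/(_ (V / Y w)%R) := uoo; apply: filterS => n.
rewrite ler_pdivrMr// => /NV Nn; rewrite /tail_sum/=.
rewrite (_ : [set k | _ && _] = exc (Z w)); last first.
  apply/seteqP; split=> k /=; first by case/andP.
  by move=> Zk; rewrite Zk andbT (leq_trans (en1 _ Zk))// (leq_trans _ Nn)// leq_addr.
apply: eq_esum => k Zk; congr F; apply/funext => i.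
rewrite /torus /window /translate wrap_id// (leq_trans _ Nn)//.
apply: (leq_trans (leq_znormD _ _)); rewrite addnC leq_add ?en1//.
exact: (valP i).
Qed.

(** Dominated convergence with the bound M |e(Z)|, integrable by [mean_exc_lty]. *)
Lemma tail_sum_cvg (n0 : nat) (F : paths (box d n0) R -> \bar R) (M : R) (u_ : R^nat) :
  measurable_fun setT F -> (forall x, 0 <= F x <= M%:E) ->
  u_ n @[n --> \oo] --> +oo%R ->
  \int[P]_w tail_sum (u_ n) (F \o window n0) (Y w, Q w) @[n --> \oo] -->
  \int[P]_w (\esum_(k in exc (Z w)) F (window n0 (translate k (Z w)))).
Proof.
move=> mF FM uoo.
have F0 x : 0 <= F x by have /andP[] := FM x.
have M0 : (0 <= M)%R.
  by rewrite -lee_fin (le_trans (F0 (cst 0%R)))//; case/andP: (FM (cst 0%R)).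
have mFw : measurable_fun setT (F \o window n0 : paths (Zd d) R -> \bar R).
  exact: (measurableT_comp mF (@measurable_window R d n0)).
have mYQ : measurable_fun setT (fun w => (Y w, Q w)) by exact: measurable_fun_pair.
have mcard : measurable_fun setT (fun w => \esum_(k in exc (Z w)) (1 : \bar R)).
  apply: (@measurable_random_esum _ _ _ _ (fun w => exc (Z w)) (fun _ _ => 1)) => //.
  exact: measurable_excZ.
have card0 w : 0 <= \esum_(k in exc (Z w)) (1 : \bar R) by exact: esum_ge0.
have := @dominated_convergence _ T R P setT measurableT
  (fun n w => tail_sum (u_ n) (F \o window n0) (Y w, Q w))
  (fun w => \esum_(k in exc (Z w)) F (window n0 (translate k (Z w))))
  (fun w => M%:E * \esum_(k in exc (Z w)) 1).
case=> //.
- by move=> n; exact: (measurableT_comp (measurable_tail_sum _ mFw (fun x => F0 _)) mYQ).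
- apply: (@measurable_random_esum _ _ _ _ (fun w => exc (Z w))
    (fun k w => F (window n0 (translate k (Z w))))) => // k.
    exact: measurable_excZ.
  apply: (measurableT_comp mFw).
  exact: (measurableT_comp (measurable_translate k) (measurable_Z Q Y)).
- apply: filterS (ae_pareto_gt1 hY) => w Y1 _.
  by apply: cvg_near_cst; apply: tail_sum_near => //; exact: lt_trans ltr01 Y1.
- apply/integrableZl => //; apply/integrableP; split=> //.
  under eq_integral do rewrite gee0_abs//.
  by rewrite -(@mean_excE _ _ _ _ P Q Y hQ0); exact: (mean_exc_lty halpha hQ0 hQalpha hY hYQ).
apply: aeW => w n _; rewrite gee0_abs; last by apply: tail_sum_ge0 => y; exact: F0.
rewrite /tail_sum /= (_ : [set k | _ && _] =
    exc (Z w) `&` [set k | (znorm k <= N (u_ n * Y w)%R)%N]); last first.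
  by apply/seteqP; split=> k /= => [/andP[]|[-> ->]].
rewrite esum_mkcondr; have finZ := l0_exc_finite (l0_Z Y hQ0 w).
apply: (@le_trans _ _ (\esum_(k in exc (Z w)) M%:E)).
  apply: le_esum => k _; case: ifP => _; last by rewrite lee_fin.
  by case/andP: (FM (window n0 (torus (N (u_ n * Y w)%R) (Y w) (Q w) k))).
rewrite !esum_fset//.
rewrite ge0_mule_fsumr//.
by under [leRHS]eq_fsbigr do rewrite mule1.
Qed.

Lemma tail_count_cvg (u_ : R^nat) : u_ n @[n --> \oo] --> +oo%R ->
  \int[P]_w tail_sum (u_ n) (cst 1) (Y w, Q w) @[n --> \oo] --> mean_exc P Z.
Proof.
move=> uoo; rewrite (@mean_excE _ _ _ _ P Q Y hQ0).
apply: (@tail_sum_cvg 0 (cst 1) 1%R u_ _ _ uoo) => // x.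
by rewrite lee_fin ler01 lexx.
Qed.

(** The constant in front of the tail integrals is a positive real, hence can be
    cancelled in extended reals. *)
Let prefactor (u : R) : (0 < u)%R -> exists2 r : R, (0 < r)%R &
  forall a, m^-1 * ((u `^ (- alpha))%:E * a) = r%:E * a.
Proof.
move=> u0; have m0 := torus_mass_gt0.
have finm : m \is a fin_num by rewrite ge0_fin_numE ?ltW.
exists ((fine m)^-1 * u `^ (- alpha))%R.
  by rewrite mulr_gt0 ?powR_gt0// invr_gt0 fine_gt0// m0.
move=> a; rewrite muleA EFinM; congr (_ * _ * _).
by rewrite -[in LHS](fineK finm) inver fine_eq0// gt_eqF.
Qed.

Lemma torus_exceed (u : R) : (1 <= u)%R ->
  mu [set x | (u < `|x 0%R|)%R] =
  m^-1 * ((u `^ (- alpha))%:E * \int[P]_w tail_sum u (cst 1) (Y w, Q w)).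
Proof.
move=> u1; rewrite -torus_tail_integral//.
by rewrite integral_cst ?mul1e//; exact: measurable_abs_gt.
Qed.

Let measurable_rescaled_window (n0 : nat) (u : R) : measurable_fun setT
  (fun x : paths (Zd d) R => window n0 (fun i => u^-1 * x i)%R).
Proof.
apply: measurable_paths => i; apply: measurable_funM; first exact: measurable_cst.
exact: measurable_coordinate.
Qed.

Lemma torus_cond_law (n0 : nat) (u : R) (F : paths (box d n0) R -> \bar R) :
  (1 <= u)%R -> 0 < mu [set x | (u < `|x 0%R|)%R] ->
  measurable_fun setT F -> (forall x, 0 <= F x) ->
  \int[cond_law mu [set x | (u < `|x 0%R|)%R]
    (fun x => window n0 (fun i => u^-1 * x i)%R)]_x F x =
  (\int[P]_w tail_sum u (cst 1) (Y w, Q w))^-1 *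
  \int[P]_w tail_sum u (F \o window n0) (Y w, Q w).
Proof.
move=> u1 mu0 mF F0; have u0 : (0 < u)%R := lt_le_trans ltr01 u1.
have mFw : measurable_fun setT (F \o window n0 : paths (Zd d) R -> \bar R).
  exact: (measurableT_comp mF (@measurable_window R d n0)).
have [nu -> ->//] := cond_law_measure (measurable_abs_gt 0%R u) mu0
  (@measurable_rescaled_window n0 u).
have := torus_tail_integral u1 mFw (fun x => F0 _); rewrite /= => ->.
rewrite torus_exceed//.
have [r r0 rE] := prefactor u0.
by rewrite !rE inve_ratio.
Qed.

Lemma tail_count_gt0 (u_ : R^nat) : u_ n @[n --> \oo] --> +oo%R ->
  \forall n \near \oo, 0 < \int[P]_w tail_sum (u_ n) (cst 1) (Y w, Q w).
Proof.
move=> /tail_count_cvg cvP; apply: (cvP [set y : \bar R | 0 < y]).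
apply: open_nbhs_nbhs; split; first exact: open_ereal_gt_ereal.
exact: (lt_le_trans lte01 (mean_exc_ge1 hQ0 hQ1 hY)).
Qed.

(** At high levels this follows from the asymptotics, hence also at lower ones. *)
Lemma torus_exceed_gt0 (u : R) : 0 < mu [set x | (u < `|x 0%R|)%R].
Proof.
have /cvgryPge/(_ (Num.max 1 u)%R) := @cvgr_idn R.
move=> /(filterI (tail_count_gt0 (@cvgr_idn R)))/filter_ex[n /= [n0]].
rewrite ge_max => /andP[n1 un].
apply: (@lt_le_trans _ _ (mu [set x | (n%:R < `|x 0%R|)%R])).
  rewrite torus_exceed//; have [r r0 ->] := prefactor (lt_le_trans ltr01 n1).
  by rewrite mule_gt0.
apply: le_measure; rewrite ?inE; [exact: measurable_abs_gt..|].
by move=> x /=; exact: le_lt_trans.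
Qed.

Context disp' (T' : measurableType disp') (P' : probability T' R).
Context (W : {RV P' >-> paths (Zd d) R}).
Hypothesis hW : exc_stationary_process P Z W.

Lemma mean_exc_gt0 : 0 < mean_exc P Z.
Proof. exact: (lt_le_trans lte01 (mean_exc_ge1 hQ0 hQ1 hY)). Qed.

Let mean_fin : mean_exc P Z \is a fin_num.
Proof. exact: (mean_exc_fin halpha hQ0 hQ1 hQalpha hY hYQ). Qed.

(** The defining property of the exceedance-stationary process concerns functions
    on E0 with values in the reals; this is the form used for limits. *)
Lemma exc_stationary_integral (F : paths (Zd d) R -> \bar R) (M : R) :
  measurable_fun setT F -> (forall x, 0 <= F x <= M%:E) ->
  \int[P']_w F (W w) =
  (mean_exc P Z)^-1 * \int[P]_w (\esum_(k in exc (Z w)) F (translate k (Z w))).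
Proof.
move=> mF FM.
have finF x : F x \is a fin_num.
  have /andP[F0 FMx] := FM x; rewrite ge0_fin_numE//.
  by apply: le_lt_trans FMx _; exact: ltry.
have FE x : F x = (fine (F x))%:E by rewrite fineK.
under eq_integral do rewrite FE.
rewrite (hW.2 (fun x => fine (F x))); last 2 first.
- apply: measurable_funTS; apply/measurable_EFinP.
  by rewrite (_ : _ \o _ = F)//; apply/funext => x /=; rewrite -FE.
- by move=> x _; rewrite fine_ge0//; case/andP: (FM x).
apply: (f_equal (fun r => (mean_exc P Z)^-1 * r)).
by apply: eq_integral => w _; apply: eq_esum => k _; rewrite -FE.
Qed.

Lemma torus_cond_cvg (n0 : nat) (F : paths (box d n0) R -> \bar R) (M : R) :
  measurable_fun setT F -> (forall x, 0 <= F x <= M%:E) ->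
  \int[cond_law mu [set x | (u < `|x 0%R|)%R]
    (fun x => window n0 (fun i => u^-1 * x i)%R)]_x F x @[u --> +oo%R] -->
  \int[P']_w F (window n0 (W w)).
Proof.
move=> mF FM; have F0 x : 0 <= F x by case/andP: (FM x).
have mFw : measurable_fun setT (F \o window n0 : paths (Zd d) R -> \bar R).
  exact: (measurableT_comp mF (@measurable_window R d n0)).
rewrite (@exc_stationary_integral (F \o window n0) M)//; last by move=> x; exact: FM.
apply/cvge_pinftyP => u_ uoo.
apply: (@cvg_trans _ ((\int[P]_w tail_sum (u_ n) (cst 1) (Y w, Q w))^-1 *
  \int[P]_w tail_sum (u_ n) (F \o window n0) (Y w, Q w) @[n --> \oo])).
  apply: near_eq_cvg; have /cvgryPge/(_ 1%R) := uoo; apply: filterS => n un1.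
  by rewrite torus_cond_law//; exact: torus_exceed_gt0.
have acv := tail_sum_cvg mF FM uoo.
have bcv := tail_count_cvg uoo.
have meanE := fineK mean_fin.
have meanV : (mean_exc P Z)^-1 = ((fine (mean_exc P Z))^-1)%:E.
  by rewrite -[in LHS]meanE inver fine_eq0// gt_eqF// mean_exc_gt0.
have mean0 : (fine (mean_exc P Z) != 0)%R by rewrite fine_eq0// gt_eqF// mean_exc_gt0.
rewrite -meanE in bcv.
have /fine_cvgP[bfin bfcv] := bcv.
have bV : (\int[P]_w tail_sum (u_ n) (cst 1) (Y w, Q w))^-1 @[n --> \oo] -->
    ((fine (mean_exc P Z))^-1)%:E.
  apply: (@cvg_trans _
    (((fine (\int[P]_w tail_sum (u_ n) (cst 1) (Y w, Q w)))^-1)%:E @[n --> \oo])).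
    apply: near_eq_cvg; have := tail_count_gt0 uoo; apply: filterS2 bfin => n bn bn0.
    by rewrite -[in RHS](fineK bn) inver fine_eq0// gt_eqF.
  apply: cvg_EFin; first exact: nearW.
  exact: cvgV.
rewrite meanV; apply: cvgeM; [|exact: bV|exact: acv].
by rewrite /mule_def; case: (\int[P]_w _) => //=; rewrite invr_eq0.
Qed.

(** Exceedances above y >= 1 of YQ are, on Y > y, the exceedances above 1 of (Y/y)Q,
    so their mean number is y^-alpha E|e(Z)| by [joint_scaling]. *)
Lemma exc_stationary_pareto : pareto P' (fun w => `|W w 0|)%R alpha.
Proof.
move=> y y1; have y0 : (0 < y)%R := lt_le_trans ltr01 y1.
pose F (x : paths (Zd d) R) : \bar R := (\1_[set x : paths (Zd d) R | (y < `|x 0%R|)%R] x)%:E.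
have mA := @measurable_abs_gt R (Zd d) 0%R y.
have mF : measurable_fun setT F by apply/measurable_EFinP; exact: measurable_indic.
pose count (u : R) (x : R * paths (Zd d) R) : \bar R :=
  \esum_(k in [set k | (u < `|x.1 * x.2 k|)%R]) 1.
have count0 u x : 0 <= count u x by exact: esum_ge0.
have mcount u : measurable_fun setT (count u).
  apply: (@measurable_random_esum _ _ _ _ (fun x : R * paths (Zd d) R =>
    [set k | (u < `|x.1 * x.2 k|)%R]) (fun _ _ => 1)) => // k.
  rewrite -[X in measurable X]setTI; apply: measurable_fun_ltr => //.
  apply: measurableT_comp => //; apply: measurable_funM; first exact: measurable_fst.
  by apply: measurable_path_comp; exact: measurable_snd.
have mYQ : measurable_fun setT (fun w => (Y w, Q w)) by exact: measurable_fun_pair.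
have mYQy : measurable_fun setT (fun w => (Y w / y, Q w)%R).
  apply: measurable_fun_pair => //.
  exact: (measurable_funM mY (measurable_cst _)).
transitivity (\int[P']_w F (W w)).
  rewrite /F (_ : (fun w => _) = (fun w => (\1_[set w | (y < `|W w 0%R|)%R] w)%:E)).
    rewrite integral_indic ?setIT//.
    by have := @measurable_funPT _ _ _ _ W measurableT _ mA; rewrite setTI.
  by apply/funext => w; rewrite !indicE; congr ((_ : bool)%:R%:E); apply/idP/idP; rewrite !inE.
rewrite (@exc_stationary_integral F 1%R)//; last first.
  by move=> x; rewrite /F !lee_fin indicE; case: (_ \in _); rewrite ?lexx ?ler01.
rewrite (_ : (\int[P]_w _) = \int[P]_w count y (Y w, Q w)); last first.
  apply: eq_integral => w _; rewrite /count /=.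
  rewrite (_ : [set k | _] = exc (Z w) `&` [set k | (y < `|Y w * Q w k|)%R]).
    rewrite esum_mkcondr; apply: eq_esum => k _; rewrite /F indicE /translate.
    rewrite (_ : (_ \in _) = (k \in [set k | (y < `|Y w * Q w k|)%R])).
      by case: (_ \in _).
    by apply/idP/idP; rewrite !inE/= add0r.
  by apply/seteqP; split=> k /= => [yk|[]//]; split=> //; exact: le_lt_trans yk.
have -> : \int[P]_w count y (Y w, Q w) =
    \int[P]_(w in [set w | (y < Y w)%R]) count 1%R (Y w / y, Q w)%R.
  rewrite [RHS]integral_mkcond; apply: ge0_ae_eq_integral => //.
  - exact: (measurableT_comp (mcount y) mYQ).
  - apply: measurable_patch; first exact: measurable_gt_level.
    exact: (measurableT_comp (mcount 1%R) mYQy).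
  - by move=> w _; rewrite patchE; case: ifP.
  apply: filterS2 (ae_pareto_gt1 hY) (ae_Q_le1 hQ1) => w Y1 Qle1 _.
  have Y0 : (0 < Y w)%R := lt_trans ltr01 Y1.
  rewrite patchE; case: ifPn => [|]; rewrite ?inE ?notin_setE/= => yY; last first.
    rewrite /count/= (_ : [set k | _] = set0) ?esum_set0//.
    by apply/seteqP; split=> // k /=; rewrite exceed_none// leNgt; exact/negP.
  rewrite /count /= (_ : [set k | (1 < _)%R] = [set k | (y < `|Y w * Q w k|)%R])//.
  by apply/seteqP; split=> k /=; rewrite exceed_scaled.
rewrite (joint_scaling hY hYQ y1 (mcount 1%R) (count0 1%R)).
rewrite (_ : \int[P]_w count 1%R (Y w, Q w) = mean_exc P Z); last first.
  by rewrite (@mean_excE _ _ _ _ P Q Y hQ0).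
by rewrite muleCA mulVe ?mule1// gt_eqF// mean_exc_gt0.
Qed.

(** The wrapped field, realised as the identity on path space under its law. *)
Definition torus_field : {RV mu >-> paths (Zd d) R} :=
  mfun_Sub (mem_set (@measurable_id _ (paths (Zd d) R) setT)).

(** A bounded test function is split into its positive and negative parts, to which
    [torus_cond_cvg] applies separately. *)
Lemma torus_tail_process : tail_process torus_field W.
Proof.
split.
- by move=> k A mA; exact: torus_law_stationary.
- rewrite (_ : [set w | _] = setT) ?probability_setT//.
  by apply/seteqP; split=> // w _; exact: (hW.1 w).1.
- by move=> u; exact: torus_exceed_gt0.
move=> n0 f cf [M fM].
have mf : measurable_fun setT (f : paths (box d n0) R -> R).
  exact: measurable_continuous (finite_boxT d n0) cf.
pose F (x : paths (box d n0) R) := (f x)%:E.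
have mF : measurable_fun setT F by exact/measurable_EFinP.
have mWn : measurable_fun setT (fun w => window n0 (W w)).
  exact: (measurableT_comp (@measurable_window R d n0) (@measurable_funPT _ _ _ _ W)).
have cvgF (G : paths (box d n0) R -> \bar R) : measurable_fun setT G ->
    (forall x, 0 <= G x <= M%:E) ->
  \int[cond_law mu [set x | (u < `|x 0%R|)%R]
    (fun x => window n0 (fun i => u^-1 * x i)%R)]_x G x @[u --> +oo%R] -->
  \int[pushforward P' (fun w => window n0 (W w))]_x G x.
  move=> mG GM; rewrite ge0_integral_pushforward//.
    exact: torus_cond_cvg GM.
  by move=> x _; case/andP: (GM x).
rewrite [X in _ --> X]integralE.
rewrite (_ : (fun u => _) = (fun u =>
   \int[cond_law mu [set x | (u < `|x 0%R|)%R]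
     (fun x => window n0 (fun i => u^-1 * x i)%R)]_x F^\+ x -
   \int[cond_law mu [set x | (u < `|x 0%R|)%R]
     (fun x => window n0 (fun i => u^-1 * x i)%R)]_x F^\- x)); last first.
  apply/funext => u.
  have [nu -> _] := cond_law_measure (measurable_abs_gt 0%R u) (torus_exceed_gt0 u)
    (@measurable_rescaled_window n0 u).
  by rewrite integralE.
have M0 : (0 <= M)%R := le_trans (normr_ge0 _) (fM point).
have FposM x : 0 <= F^\+ x <= M%:E.
  rewrite funepos_ge0 /= funeposE ge_max !lee_fin M0 andbT.
  exact: le_trans (ler_norm _) (fM x).
have FnegM x : 0 <= F^\- x <= M%:E.
  rewrite funeneg_ge0 /= funenegE ge_max !lee_fin M0 andbT.
  by apply: le_trans (fM x); rewrite -normrN ler_norm.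
have mFpos := measurable_funepos mF.
have mFneg := measurable_funeneg mF.
apply: cvgeB; [|exact: cvgF|exact: cvgF].
apply: fin_num_adde_defr; rewrite ge0_fin_numE; last first.
  by apply: integral_ge0 => x _; case/andP: (FposM x).
rewrite ge0_integral_pushforward//.
rewrite preimage_setT; apply: (@le_lt_trans _ _ (\int[P']_w M%:E)); last first.
  have -> : \int[P']_w M%:E = M%:E * P' setT by rewrite -integral_cst.
  by rewrite (@probability_setT _ _ _ P') mule1 ltry.
apply: ge0_le_integral => //.
- by move=> w _; case/andP: (FposM (window n0 (W w))).
- exact: (measurableT_comp mFpos mWn).
- by move=> w _; case/andP: (FposM (window n0 (W w))).
Qed.

End Torus.

(** * Exceedance-stationary processes are tail processes *)

Theorem proposition3p11 (R : realType) (d : nat) (hd : (0 < d)%N)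
    (disp : measure_display) (T : measurableType disp) (P : probability T R)
    (alpha : R) (halpha : 0 < alpha)
    (Q : {RV P >-> paths (Zd d) R})
    (hQ0 : forall w, l0 (Q w))
    (hQ1 : {ae P, forall w, supnorm (Q w) = 1%E})
    (hQalpha :
       (\int[P]_w (\esum_(k in [set: Zd d]) (`|Q w k| `^ alpha)%:E) < +oo)%E)
    (Y : {RV P >-> R}) (hY : pareto P Y alpha)
    (hYQ : independent Y Q) :
  let Z : T -> paths (Zd d) R := fun w i => Y w * Q w i in
  [/\ (mean_exc P Z < +oo)%E,
      exists (disp' : measure_display) (T' : measurableType disp')
             (P' : probability T' R) (W : {RV P' >-> paths (Zd d) R}),
        exc_stationary_process P Z W &
      forall (disp' : measure_display) (T' : measurableType disp')
             (P' : probability T' R) (W : {RV P' >-> paths (Zd d) R}),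
        exc_stationary_process P Z W ->
        exists (disp'' : measure_display) (T'' : measurableType disp'')
               (P'' : probability T'' R) (X : {RV P'' >-> paths (Zd d) R}),
          regularly_varying X alpha /\ tail_process X W].
Proof.
move=> Z; split.
- exact: (mean_exc_lty halpha hQ0 hQalpha hY hYQ).
- exact: (exists_exc_stationary halpha hQ0 hQ1 hQalpha hY hYQ).
move=> disp' T' P' W hW.
have [N [mN Nfin Ninf]] := exists_torus_scale d halpha hY.
have [mu muE] := exists_torus_law Q mN Nfin.
have tailW := torus_tail_process halpha hQ0 hQ1 hQalpha hY hYQ mN Nfin Ninf muE hW.
exists _, (paths (Zd d) R), mu, (torus_field mu); split=> //.
exists disp', T', P', W; split=> //.
exact: (exc_stationary_pareto halpha hQ0 hQ1 hQalpha hY hYQ hW).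
Qed.
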